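(* Let $(\Phi,\Delta)$ be an infinite based root system in $(V,B)$ with $\Delta$ a basis of $V$, and let $E$ be the set of limit points (accumulation points) of its normalized roots. Then the union $E_2$ of all limit roots arising from dihedral reflection subgroups is dense in $E$.
   Context: Let $V$ be a finite-dimensional real vector space with a symmetric bilinear form $B$. For $\alpha\in V$ with $B(\alpha,\alpha)\neq 0$, let $s_\alpha(v)=v-2\frac{B(\alpha,v)}{B(\alpha,\alpha)}\alpha$ for $v\in V$. A simple system is a finite subset $\Delta\subset V$ such that: (1) $\Delta$ is positively independent (if $\sum_{\alpha\in\Delta}\lambda_\alpha\alpha=0$ with all $\lambda_\alpha\ge 0$ then all $\lambda_\alpha=0$); (2) for distinct $\alpha,\beta\in\Delta$, $B(\alpha,\beta)\in(-\infty,-1]\cup\{-\cos(\pi/k): k\in\mathbb{Z}_{\ge 2}\}$; (3) $B(\alpha,\alpha)=1$ for all $\alpha\in\Delta$. Let $W$ be the subgroup of the orthogonal group $O_B(V)$ generated by $S=\{s_\alpha:\alpha\in\Delta\}$ and $\Phi=W(\Delta)$ the orbit of $\Delta$. The pair $(\Phi,\Delta)$ is called a based root system in $(V,B)$; $(W,S)$ is a Coxeter system. Let $\mathrm{cone}(\Delta)$ be the set of nonnegative linear combinations of $\Delta$ and $\Phi^+=\Phi\cap\mathrm{cone}(\Delta)$ the set of positive roots; then $\Phi=\Phi^+\sqcup(-\Phi^+)$. Standing assumption: $\Delta$ is a basis of $V$. For $v=\sum_{\alpha\in\Delta}v_\alpha\alpha$ put $|v|_1=\sum_{\alpha\in\Delta}v_\alpha$,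 $V_0=\{v:|v|_1=0\}$, $V_1=\{v:|v|_1=1\}$. For $v\in V\setminus V_0$ put $\widehat v=v/|v|_1\in V_1$. One has $\Phi\cap V_0=\emptyset$, and $\widehat\Phi=\{\widehat\rho:\rho\in\Phi\}$ is the set of normalized roots. $E=E(\Phi)$ (the set of limit roots) is the set of all limits of convergent injective sequences of elements of $\widehat\Phi$. Put $q(v)=B(v,v)$, $Q=\{v\in V:q(v)=0\}$, $\widehat Q=Q\cap V_1$. For two distinct positive roots $\rho_1,\rho_2$, let $W'=\langle s_{\rho_1},s_{\rho_2}\rangle$ be the dihedral reflection subgroup they generate, $\Phi'=\{\rho\in\Phi: s_\rho\in W'\}$, and $E(\Phi')\subseteq E$ the set of limits of convergent injective sequences of elements of $\widehat{\Phi'}=\{\widehat\rho:\rho\in\Phi'\}$. The set $E_2\subseteq E$ is the union of the sets $E(\Phi')$ over all such pairs; equivalently, $E_2=\bigcup_{\rho_1,\rho_2\in\Phi^+}L(\widehat{\rho_1},\widehat{\rho_2})\cap\widehat Q$, where $L(x,y)=\{\lambda x+(1-\lambda)y:\lambda\in\mathbb R\}$ is the line through $x$ and $y$ (a point if $x=y$). *)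

(* Defs.v *)
From HB Require Import structures.
From mathcomp Require Import all_boot all_order all_algebra.
From mathcomp Require Import all_classical all_reals all_analysis.

Set Implicit Arguments.
Unset Strict Implicit.
Unset Printing Implicit Defensive.
Import Order.TTheory GRing.Theory Num.Theory.
Import numFieldNormedType.Exports.
Local Open Scope classical_set_scope.
Local Open Scope ring_scope.

(* The canonical topology of a finite-dimensional real vector space, pulled
   back from R^n along the coordinate isomorphism [v2r]. *)
Definition vtop (R : realType) (V : vectType R) : Type :=
  initial_topology (@VectorInternalTheory.v2r R V).

HB.instance Definition _ (R : realType) (V : vectType R) :=
  Topological.copy (vtop V) (initial_topology (@VectorInternalTheory.v2r R V)).

Definition dense_in (T : topologicalType) (D A : set T) : Prop :=
  D `<=` A /\ A `<=` closure D.

Section BasedRootSystem.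
Variables (R : realType) (V : vectType R) (B : {symmetric V}).

Definition reflection (a : V) : 'End(V) :=
  linfun (fun v : V => v - (2 * B a v / B a a) *: a).

Lemma reflectionE (a v : V) :
  reflection a v = v - (2 * B a v / B a a) *: a.
Proof.
pose f (v : V) : V := v - (2 * B a v / B a a) *: a.
have f_lin : linear f.
  move=> c x y; rewrite /f linearDr linearZr /= scalerBr scalerA addrACA.
  by rewrite -opprD -scalerDl mulrDr mulrDl !mulrA [2 * c]mulrC.
pose lM := GRing.isLinear.Build R V V _ f f_lin.
pose fL : {linear V -> V} := HB.pack f lM.
exact: (lfunE fL v).
Qed.

(* A form [B] may be degenerate, so invertibility does not follow from the
   invariance of [B]. *)
Definition orthogonal_group : set 'End(V) :=
  [set f | lker f = 0%VS /\ forall x y, B (f x) (f y) = B x y].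

Definition is_subgroup (G : set 'End(V)) : Prop :=
  [/\ G `<=` orthogonal_group, G \1%VF,
      forall f g, G f -> G g -> G (f \o g)%VF &
      forall f, G f -> G (f^-1)%VF].

(* Meant for [X `<=` orthogonal_group]; for other [X] no subgroup contains [X]
   and the intersection is the full set. *)
Definition generated_by (X : set 'End(V)) : set 'End(V) :=
  smallest is_subgroup X.

(* Finite subsets of [V] are given by lists. *)
Definition positively_independent (Delta : seq V) : Prop :=
  forall c : V -> R, (forall a, a \in Delta -> 0 <= c a) ->
    \sum_(a <- Delta) c a *: a = 0 -> forall a, a \in Delta -> c a = 0.

Record simple_system (Delta : seq V) : Prop := SimpleSystem {
  simple_uniq : uniq Delta;
  simple_posindep : positively_independent Delta;
  simple_form : forall a b, a \in Delta -> b \in Delta -> a != b ->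
    B a b <= -1 \/ exists2 k : nat, (2 <= k)%N & B a b = - cos (pi / k%:R);
  simple_norm : forall a, a \in Delta -> B a a = 1 }.

Definition weyl_group (Delta : seq V) : set 'End(V) :=
  generated_by [set reflection a | a in [set` Delta]].

Definition based_root_system (Phi : set V) (Delta : seq V) : Prop :=
  simple_system Delta /\
  Phi = [set w a | w in weyl_group Delta & a in [set` Delta]].

Definition cone (Delta : seq V) : set V :=
  [set v | exists2 c : V -> R, (forall a, a \in Delta -> 0 <= c a) &
                               v = \sum_(a <- Delta) c a *: a].

Definition positive_roots (Phi : set V) (Delta : seq V) : set V :=
  Phi `&` cone Delta.

(* The sum of the coordinates of [v] in [Delta]; this is a linear form, not a
   norm. *)
Definition height (Delta : seq V) (v : V) : R :=
  \sum_(i < size Delta) coord (in_tuple Delta) i v.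

(* Only meaningful for vectors of nonzero height, which roots are. *)
Definition normalize (Delta : seq V) (v : V) : V := (height Delta v)^-1 *: v.

Definition limit_roots (Delta : seq V) (A : set V) : set (vtop V) :=
  [set x | exists u : nat -> vtop V,
     [/\ injective u,
         forall n, [set normalize Delta r | r in A] (u n) &
         u @ \oo --> x]].

(* The roots whose reflection lies in <s_r1, s_r2>. *)
Definition dihedral_roots (Phi : set V) (r1 r2 : V) : set V :=
  [set r | Phi r /\
           generated_by [set reflection r1; reflection r2] (reflection r)].

Definition dihedral_limit_roots (Phi : set V) (Delta : seq V) : set (vtop V) :=
  [set x | exists r1 r2 : V,
     [/\ positive_roots Phi Delta r1, positive_roots Phi Delta r2, r1 <> r2 &
         limit_roots Delta (dihedral_roots Phi r1 r2) x]].

End BasedRootSystem.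

(* Main.v *)
Require Import Defs.
From mathcomp Require Import all_boot all_order all_algebra.
From mathcomp Require Import all_classical all_reals all_analysis.
From mathcomp Require Import ring lra.

(** Let x be a limit root, the limit of normalized positive roots u_n. Roots
    have norm 1, and only finitely many positive roots have bounded height
    ([finite_low_roots]): two distinct ones that are close would give an element
    s_r s_r' of the Weyl group close to 1, which must be 1 because an element
    that keeps all simple roots positive is trivial ([positive_word_trivial]).
    Hence q(u_n) -> 0 and q(x) = 0. These facts rest on the dichotomy that every
    root is positive or negative ([act_simple_sign]), proved by induction on
    length and reduction to dihedral groups.

    The link with dihedral subgroups is [dihedral_limit]: if r1, r2 are distinct
    positive roots, every isotropic point of the line through their
    normalizations is a limit root of the subgroup generated by s_r1 and s_r2.
    The roots of that subgroup are given by Chebyshev polynomials, and their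
    directions converge to the isotropic one.

    If B(a, x) <> 0 for some simple a, the line through x and a crosses the
    quadric q = 0 transversally at x. As q(u_n) -> 0, the line through u_n and a
    then crosses the quadric at a point that tends to x, and this point is a
    dihedral limit root ([nonradical_limit]).

    Otherwise x lies in the radical of B, and x itself is a dihedral limit root.
    On the span of the support of x the form is positive semidefinite, and its
    isotropic vectors are the multiples of x ([isotropic_radical]): this is the
    affine case. There B takes finitely many values on pairs of roots
    ([finite_form_values]): if |B(r, a)| < 1, some linear form p with p(x) = 1
    vanishes at r and a; the Weyl group moves p into the fundamental alcove, and
    with it the pair into one of finitely many finite root subsystems. By the
    pigeonhole principle two of infinitely many roots agree modulo the radical,
    and the line through them contains x ([radical_limit]). *)

Set Implicit Arguments.
Unset Strict Implicit.
Unset Printing Implicit Defensive.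
Import Order.TTheory GRing.Theory Num.Theory.
Import numFieldNormedType.Exports.
Local Open Scope classical_set_scope.
Local Open Scope ring_scope.

(** * Reflections and words *)

Section Form.
Variables (R : realType) (V : vectType R) (B : {symmetric V}).
Implicit Types (a b u v : V) (w : seq V) (c : R).

Lemma formC u v : B u v = B v u.
Proof. by rewrite hermC /= expr0 mul1r. Qed.

Lemma formDl u v y : B (u + v) y = B u y + B v y.
Proof. exact: linearDl. Qed.
Lemma formDr u v y : B y (u + v) = B y u + B y v.
Proof. exact: linearDr. Qed.
Lemma formBl u v y : B (u - v) y = B u y - B v y.
Proof. exact: linearBl. Qed.
Lemma formBr u v y : B y (u - v) = B y u - B y v.
Proof. exact: linearBr. Qed.
Lemma formNl u v : B (- u) v = - B u v.
Proof. exact: linearNl. Qed.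
Lemma formNr u v : B u (- v) = - B u v.
Proof. exact: linearNr. Qed.
Lemma formZl c u v : B (c *: u) v = c * B u v.
Proof. by rewrite formC linearZr /= formC. Qed.
Lemma formZr c u v : B u (c *: v) = c * B u v.
Proof. by rewrite linearZr. Qed.
Lemma form_suml I (r : seq I) (P : pred I) (F : I -> V) y :
  B (\sum_(i <- r | P i) F i) y = \sum_(i <- r | P i) B (F i) y.
Proof. exact: linear_sumlz. Qed.
Lemma form_sumr I (r : seq I) (P : pred I) (F : I -> V) y :
  B y (\sum_(i <- r | P i) F i) = \sum_(i <- r | P i) B y (F i).
Proof. exact: raddf_sum. Qed.

Definition formE := (formDl, formDr, formBl, formBr, formNl, formNr,
  formZl, formZr).

Local Notation s := (reflection B).

Lemma unit_reflectionE a v : B a a = 1 -> s a v = v - (2 * B a v) *: a.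
Proof. by move=> a1; rewrite reflectionE a1 divr1. Qed.

Lemma reflection_root a : B a a = 1 -> s a a = - a.
Proof.
move=> a1; rewrite unit_reflectionE // a1 mulr1 -{1}[a]scale1r -scalerBl.
by rewrite (_ : 1 - 2 = -1) ?scaleN1r //; lra.
Qed.

Lemma reflection_invol a v : B a a = 1 -> s a (s a v) = v.
Proof.
move=> a1; rewrite [s a v]unit_reflectionE // linearB linearZ /=.
rewrite reflection_root // unit_reflectionE // scalerN opprK.
by rewrite addrNK.
Qed.

Lemma reflection_isometry a u v : B a a = 1 -> B (s a u) (s a v) = B u v.
Proof.
move=> a1; rewrite !unit_reflectionE // !formE (formC u a) a1; ring.
Qed.

Lemma reflection_fix a v : B a v = 0 -> s a v = v.
Proof. by move=> av; rewrite reflectionE av mulr0 mul0r scale0r subr0. Qed.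

Lemma reflection_conj (g : 'End(V)) a v :
  (forall x y, B (g x) (g y) = B x y) -> s (g a) (g v) = g (s a v).
Proof. by move=> gi; rewrite !reflectionE !gi linearB [in RHS]linearZ. Qed.

(** Words carry the length function of the Weyl group. The rightmost letter acts
    first. *)
Definition act w : 'End(V) := foldr (fun a f => (s a \o f)%VF) \1%VF w.

Lemma act_nil v : act [::] v = v.
Proof. by rewrite /= id_lfunE. Qed.

Lemma act_cons a w v : act (a :: w) v = s a (act w v).
Proof. by rewrite /= comp_lfunE. Qed.

Lemma act_cat w1 w2 v : act (w1 ++ w2) v = act w1 (act w2 v).
Proof. by elim: w1 => [|a w1 IH]; rewrite ?act_nil // cat_cons !act_cons IH. Qed.

Lemma act_rcons w a v : act (rcons w a) v = act w (s a v).
Proof. by rewrite -cats1 act_cat act_cons act_nil. Qed.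

Lemma actD w u v : act w (u + v) = act w u + act w v.
Proof. exact: linearD. Qed.
Lemma actZ w c v : act w (c *: v) = c *: act w v.
Proof. exact: linearZ. Qed.
Lemma actN w v : act w (- v) = - act w v.
Proof. exact: linearN. Qed.

Definition unit_word w := forall a, a \in w -> B a a = 1.

Lemma unit_word_cons a w : unit_word (a :: w) -> B a a = 1 /\ unit_word w.
Proof.
by move=> h; split=> [|b bw]; apply: h; rewrite ?mem_head // in_cons bw orbT.
Qed.

Lemma act_isometry w u v : unit_word w -> B (act w u) (act w v) = B u v.
Proof.
elim: w => [|a w IH]; first by rewrite !act_nil.
by move=> /unit_word_cons[a1 hw]; rewrite !act_cons reflection_isometry // IH.
Qed.

Lemma act_revK w v : unit_word w -> act (rev w) (act w v) = v.
Proof.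
elim: w v => [|a w IH] v; first by rewrite !act_nil.
move=> /unit_word_cons[a1 hw].
by rewrite act_cons rev_cons act_rcons reflection_invol // IH.
Qed.

Lemma act_rcons2 w a v : B a a = 1 -> act (rcons (rcons w a) a) v = act w v.
Proof. by move=> a1; rewrite !act_rcons reflection_invol. Qed.

Lemma unit_word_rev w : unit_word w -> unit_word (rev w).
Proof. by move=> h a; rewrite mem_rev; apply: h. Qed.

Lemma act_Krev w v : unit_word w -> act w (act (rev w) v) = v.
Proof. by move=> h; rewrite -{1}(revK w) act_revK //; apply: unit_word_rev. Qed.

Lemma act_reflection w a : unit_word w ->
  s (act w a) = act (w ++ a :: rev w).
Proof.
move=> hw; apply/lfunP => v; rewrite act_cat act_cons.
by rewrite -reflection_conj ?act_Krev // => x y; apply: act_isometry.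
Qed.

(** * Dihedral groups *)

(** The Chebyshev polynomials of the second kind, shifted by one:
    cheb c k.+1 is U_k evaluated at c. *)
Fixpoint cheb2 c k : R * R :=
  if k is k'.+1 then let: (x, y) := cheb2 c k' in (y, 2 * c * y - x)
  else (0, 1).
Definition cheb c k := (cheb2 c k).1.

Lemma cheb0 c : cheb c 0 = 0. Proof. by []. Qed.
Lemma cheb1 c : cheb c 1 = 1. Proof. by []. Qed.
Lemma chebSS c k : cheb c k.+2 = 2 * c * cheb c k.+1 - cheb c k.
Proof. by rewrite /cheb /=; case: (cheb2 c k). Qed.

(** The recursion gives
    |cheb c k.+2| - |cheb c k.+1| >= |cheb c k.+1| - |cheb c k|. *)
Lemma cheb_norm_incr c k : 1 <= `|c| -> `|cheb c k| + 1 <= `|cheb c k.+1|.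
Proof.
move=> c1; elim: k => [|k IH]; first by rewrite cheb0 cheb1 normr0 normr1 add0r.
rewrite chebSS.
apply: le_trans (lerB_dist _ _); rewrite !normrM (ger0_norm (_ : 0 <= 2)) //.
have : 0 <= (`|c| - 1) * `|cheb c k.+1| by rewrite mulr_ge0 // subr_ge0.
nra.
Qed.

Lemma cheb_norm_ge c k : 1 <= `|c| -> k%:R <= `|cheb c k|.
Proof.
move=> c1; elim: k => [|k IH]; first by rewrite normr_ge0.
by rewrite -natr1; have := cheb_norm_incr k c1; lra.
Qed.

Lemma cheb_norm_inj c j k : 1 <= `|c| -> `|cheb c j| = `|cheb c k| -> j = k.
Proof.
move=> c1; have lt i d : `|cheb c i| < `|cheb c (i + d).+1|.
  elim: d => [|d IH]; first by rewrite addn0; have := cheb_norm_incr i c1; lra.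
  by rewrite addnS; have := cheb_norm_incr (i + d).+1 c1; lra.
move=> e; case: (ltngtP j k) => // h; last first.
  by have := lt k (j - k.+1)%N; rewrite -addSn subnKC // e ltxx.
by have := lt j (k - j.+1)%N; rewrite -addSn subnKC // e ltxx.
Qed.

Lemma cheb_ge0_incr c k : 1 <= c -> 0 <= cheb c k <= cheb c k.+1.
Proof.
move=> c1; elim: k => [|k IH]; first by rewrite cheb0 cheb1; lra.
by rewrite chebSS; move: IH; nra.
Qed.

Lemma cheb_sin (t : R) k : cheb (cos t) k * sin t = sin (k%:R * t).
Proof.
suff: cheb (cos t) k * sin t = sin (k%:R * t) /\
      cheb (cos t) k.+1 * sin t = sin (k.+1%:R * t) by case.
elim: k => [|k [IH1 IH2]].
  by rewrite cheb0 cheb1 !mul0r sin0 !mul1r.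
split=> //; rewrite chebSS mulrBl IH1 -(mulrA (2 * cos t)) IH2.
have -> : k.+2%:R * t = k.+1%:R * t + t by rewrite -natr1; ring.
have -> : k%:R * t = k.+1%:R * t - t by rewrite -(natr1 k); ring.
by rewrite sinB sinD; ring.
Qed.

(** The word grows on the left, so its rightmost letter stays t and each word
    is a suffix of the longer ones. *)
Fixpoint altw a t k : seq V :=
  if k is k'.+1 then (if odd k' then a else t) :: altw a t k' else [::].

Lemma altwS a t k : altw a t k.+1 = (if odd k then a else t) :: altw a t k.
Proof. by []. Qed.

Lemma size_altw a t k : size (altw a t k) = k.
Proof. by elim: k => //= k ->. Qed.

Lemma altw_rcons a t k : altw a t k.+1 = rcons (altw t a k) t.
Proof.
elim: k => //= k <-; rewrite /=.
by case: (odd k).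
Qed.

Lemma mem_altw a t k x : x \in altw a t k -> x = a \/ x = t.
Proof.
elim: k => //= k IH; rewrite in_cons => /orP[/eqP->|//].
by case: (odd k); [left|right].
Qed.

Lemma altw_suffix a t d k : exists X, altw a t (d + k) = X ++ altw a t k.
Proof.
elim: d => [|d [X IH]]; first by exists [::].
by rewrite addSn /= IH; eexists (_ :: X).
Qed.

(** The k-th root reached from a by alternating the reflections in a and t, up
    to exchanging a and t. *)
Definition dihedral_root a t k :=
  cheb (- B a t) k.+1 *: a + cheb (- B a t) k *: t.

Lemma dihedral_root0 a t : dihedral_root a t 0 = a.
Proof. by rewrite /dihedral_root cheb0 cheb1 scale1r scale0r addr0. Qed.

Lemma dihedral_rootS a t k : B a a = 1 ->
  s a (dihedral_root t a k) = dihedral_root a t k.+1.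
Proof.
move=> a1; rewrite /dihedral_root (formC t a) linearD !linearZ /=.
rewrite reflection_root // unit_reflectionE // chebSS.
set x := cheb _ k.+1; set y := cheb _ k.
rewrite scalerBr scalerN scalerA -addrA -opprD -scalerDl addrC -scaleNr.
by congr (_ *: _ + _); ring.
Qed.

Lemma act_altw a t k : B a a = 1 -> B t t = 1 ->
  act (altw a t k) a =
  if odd k then dihedral_root t a k else dihedral_root a t k.
Proof.
move=> a1 t1; elim: k => [|k IH]; first by rewrite /= id_lfunE dihedral_root0.
by rewrite altwS act_cons IH /=; case: (odd k); rewrite /= dihedral_rootS.
Qed.
End Form.

Section Braid.
Variables (R : realType) (V : vectType R) (B : {symmetric V}).
Implicit Types (a t u v p : V) (w : seq V) (c : R).

Lemma act_fix w p : (forall a, a \in w -> B a p = 0) -> act B w p = p.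
Proof.
elim: w => [|a w IH] h; first by rewrite act_nil.
rewrite act_cons IH ?reflection_fix ?h ?mem_head // => b bw.
by apply: h; rewrite in_cons bw orbT.
Qed.

Lemma braid_root a t m : B a a = 1 -> B t t = 1 -> (0 < m)%N ->
    cheb (- B a t) m = 0 -> cheb (- B a t) m.+1 = -1 ->
    cheb (- B a t) m.-1 = 1 ->
  act B (altw a t m) a = act B (altw t a m) a.
Proof.
case: m => // m a1 t1 _ c0 c1; rewrite [m.+1.-1]/= => c2.
rewrite [in RHS]altw_rcons act_rcons.
rewrite reflection_root // actN !act_altw // /dihedral_root.
rewrite !(formC B t a) c0 c1 c2.
rewrite /=; case: (odd m);
  by rewrite /= ?scale0r ?scale1r ?scaleN1r ?addr0 ?add0r.
Qed.

(** The two longest alternating words act alike on the nondegenerate plane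
    spanned by a and t, and both fix its orthogonal complement. *)
Lemma braid a t m : B a a = 1 -> B t t = 1 -> (0 < m)%N ->
    (B a t) ^+ 2 != 1 ->
    cheb (- B a t) m = 0 -> cheb (- B a t) m.+1 = -1 ->
    cheb (- B a t) m.-1 = 1 ->
  act B (altw a t m) = act B (altw t a m).
Proof.
move=> a1 t1 m0 c1 e0 e1 e2; apply/lfunP => v.
set c := B a t in c1.
have d0 : 1 - c ^+ 2 != 0 by rewrite subr_eq0 eq_sym.
pose x := (B a v - c * B t v) / (1 - c ^+ 2).
pose y := (B t v - c * B a v) / (1 - c ^+ 2).
have -> : v = (v - x *: a - y *: t) + (x *: a + y *: t).
  by rewrite -[v - _ - _]addrA -opprD addrNK.
set p := _ - y *: t.
have ap : B a p = 0.
  by rewrite /p !formE a1 -/c /x /y; field.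
have tp : B t p = 0.
  by rewrite /p !formE t1 (formC B t a) -/c /x /y; field.
have fixp w : (forall z, z \in w -> z = a \/ z = t) -> act B w p = p.
  by move=> h; apply: act_fix => z /h [] ->.
clearbody p; rewrite !actD !actZ !fixp; first last.
- by move=> z /mem_altw[] ->; [left|right].
- by move=> z /mem_altw[] ->; [right|left].
have -> : act B (altw a t m) a = act B (altw t a m) a by apply: braid_root.
suff -> : act B (altw t a m) t = act B (altw a t m) t by [].
by apply: braid_root => //; rewrite formC.
Qed.

Lemma altw_normal_form a t (j : seq V) : B a a = 1 -> B t t = 1 ->
    (forall z, z \in j -> z = a \/ z = t) ->
  exists2 k, (k <= size j)%N &
    act B j = act B (altw a t k) \/ act B j = act B (altw t a k).
Proof.
move=> a1 t1; elim: j => [|z j IH] hj; first by exists 0%N => //; left.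
have [|k kj] := IH; first by move=> y yj; apply: hj; rewrite in_cons yj orbT.
have aux p q : B p p = 1 -> B q q = 1 -> z = p \/ z = q ->
    act B j = act B (altw p q k) ->
    exists2 k, (k <= size (z :: j))%N &
      act B (z :: j) = act B (altw p q k) \/ act B (z :: j) = act B (altw q p k).
  move=> p1 q1 hz jE.
  have consE : act B (z :: j) = act B (z :: altw p q k).
    by apply/lfunP => v; rewrite !act_cons jE.
  have cancel k' : B z z = 1 ->
      act B (z :: z :: altw p q k') = act B (altw p q k').
    by move=> z1; apply/lfunP => v; rewrite !act_cons reflection_invol.
  rewrite consE; case: k kj jE {consE} => [|k] kj jE.
    exists 1%N => //; case: hz => ->; [right|left] => //.
  have [zE|zE] : z = (if odd k then p else q) \/ z = (if odd k then q else p).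
  - by case: (odd k); case: hz; [left|right|right|left].
  - exists k; first exact: leq_trans (ltnW kj) (leqnSn _).
    left; rewrite altwS -zE cancel //.
    by case: hz => ->.
  - exists k.+2 => //; left; rewrite (_ : altw p q k.+2 = z :: altw p q k.+1) //.
    by rewrite altwS zE /=; case: (odd k).
move=> [jE|jE].
  by apply: aux => //; apply: hj; rewrite mem_head.
have [||||k' h1 h2] := aux t a => //.
  by case: (hj z (mem_head _ _)); [right|left].
by exists k' => //; case: h2; [right|left].
Qed.
End Braid.

Section DihedralPositivity.
Variables (R : realType) (V : vectType R) (B : {symmetric V}).
Implicit Types (a t u v p : V) (w : seq V) (c : R).

(** In an infinite dihedral group every alternating word is reduced and the
    Chebyshev coefficients grow; in the group of order 2m they are the ratios
    sin (k pi / m) / sin (pi / m), which are nonnegative up to the longest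
    word, where the braid relation lets a be cancelled. *)
Lemma dihedral_positivity a t (j : seq V) : B a a = 1 -> B t t = 1 ->
    (B a t <= -1 \/ exists2 k : nat, (2 <= k)%N & B a t = - cos (pi / k%:R)) ->
    (forall z, z \in j -> z = a \/ z = t) ->
  (exists x y, [/\ 0 <= x, 0 <= y & act B j a = x *: a + y *: t]) \/
  (exists u : seq V, [/\ (size u < size j)%N, act B u = act B (rcons j a) &
                 forall z, z \in u -> z = a \/ z = t]).
Proof.
move=> a1 t1 hat hj.
have [k kj [jE|jE]] := altw_normal_form a1 t1 hj; last first.
  case: k kj jE => [|k] kj jE.
    left; exists 1, 0; rewrite jE /= id_lfunE scale1r scale0r addr0.
    by split.
  right; exists (altw a t k); split.
  - by rewrite size_altw.
  - apply/lfunP => v; rewrite act_rcons jE altw_rcons act_rcons.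
    by rewrite reflection_invol.
  - exact: mem_altw.
have good : 0 <= cheb (- B a t) k -> 0 <= cheb (- B a t) k.+1 ->
  exists x y, [/\ 0 <= x, 0 <= y & act B j a = x *: a + y *: t].
  move=> h1 h2; rewrite jE act_altw // /dihedral_root (formC B t a).
  case: (odd k); last by eexists _, _; split; last reflexivity.
  by rewrite addrC; eexists _, _; split; last reflexivity.
case: hat => [h|[m m2 h]].
  left; have c1 : 1 <= - B a t by lra.
  by apply: good; [have := cheb_ge0_incr k c1 | have := cheb_ge0_incr k.+1 c1];
    case/andP.
have m0 : (0 : R) < m%:R by rewrite ltr0n (leq_trans _ m2).
set th := pi / m%:R in h.
have thp : 0 < th by rewrite divr_gt0 // pi_gt0.
have mth : m%:R * th = pi by rewrite mulrC divfK // gt_eqF.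
have thlt : th < pi.
  rewrite -mth ltr_pMl // ltr1n //.
have sth : 0 < sin th by rewrite sin_gt0_pi // thp thlt.
have chebE n : cheb (- B a t) n = sin (n%:R * th) / sin th.
  by rewrite h opprK -cheb_sin mulfK // gt_eqF.
have chebge0 n : (n <= m)%N -> 0 <= cheb (- B a t) n.
  move=> nm; rewrite chebE divr_ge0 ?(ltW sth) // sin_ge0_pi //.
  by rewrite mulr_ge0 ?(ltW thp) //= -mth ler_pM2r // ler_nat.
case: (ltnP k m) => km.
  by left; apply: good; apply: chebge0 => //; apply: ltnW.
(* The last m letters can be rewritten by the braid relation to end in a. *)
right; have [X XE] := altw_suffix a t (k - m) m.
rewrite subnK // in XE.
have sX : (size X + m = k)%N.
  by rewrite -(size_altw a t k) XE size_cat size_altw.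
have bE : act B (altw a t m) = act B (altw t a m).
  apply: braid => //.
  - by rewrite (leq_trans _ m2).
  - rewrite h sqrrN; apply/eqP => e; have := cos2Dsin2 th.
    by rewrite e; have := exprn_gt0 2 sth; lra.
  - by rewrite chebE mth sinpi mul0r.
  - rewrite chebE -natr1 mulrDl mul1r mth addrC sinDpi mulNr divff // gt_eqF //.
  - rewrite chebE (_ : m.-1%:R = m%:R - 1).
      rewrite mulrBl mul1r mth sinB sinpi cospi mul0r mulN1r sub0r opprK.
      by rewrite divff // gt_eqF.
    case: m m2 {h m0 th thp mth thlt sth chebE chebge0 km XE sX} => // m _.
    by rewrite -[in RHS]natr1 addrK.
case: m m2 sX XE bE {h m0 th thp mth thlt sth chebE chebge0 km} =>
  // m m2 sX XE bE.
exists (X ++ altw a t m); split.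
- by rewrite size_cat size_altw (leq_trans _ kj) // -sX addnS.
- apply/lfunP => v; rewrite act_rcons jE XE !act_cat bE altw_rcons act_rcons.
  by rewrite reflection_invol.
- move=> z; rewrite mem_cat => /orP[zX|]; last exact: mem_altw.
  by apply: (@mem_altw _ _ a t k); rewrite XE mem_cat zX.
Qed.
End DihedralPositivity.

(** * Coordinates in the basis of simple roots *)

Section Coordinates.
Variables (R : realType) (V : vectType R) (Delta : seq V).
Hypothesis hb : basis_of fullv Delta.
Implicit Types (v : V) (i j : 'I_(size Delta)).
Local Notation co := (coord (in_tuple Delta)).

Lemma coord_sumE v : v = \sum_i co i v *: Delta`_i.
Proof. by apply: (coord_basis (X := in_tuple Delta) hb (memvf v)). Qed.

Lemma coord_is_add i u v : co i (u + v) = co i u + co i v.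
Proof. exact: linearD. Qed.
Lemma coord_is_sub i u v : co i (u - v) = co i u - co i v.
Proof. exact: linearB. Qed.
Lemma coord_is_opp i v : co i (- v) = - co i v.
Proof. exact: linearN. Qed.
Lemma coord_is_scale i c v : co i (c *: v) = c * co i v.
Proof. exact: linearZ. Qed.
Definition coordinateE :=
  (coord_is_add, coord_is_sub, coord_is_opp, coord_is_scale).

Lemma coord_inj u v : (forall i, co i u = co i v) -> u = v.
Proof.
move=> h; rewrite [u]coord_sumE [v]coord_sumE.
by apply: eq_bigr => i _; rewrite h.
Qed.

Lemma coord_simple i j : co i Delta`_j = (i == j)%:R.
Proof.
by rewrite (coord_free (X := in_tuple Delta)) 1?eq_sym //; apply: basis_free hb.
Qed.

Lemma coord_lincomb (k : 'I_(size Delta) -> R) i :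
  co i (\sum_j k j *: Delta`_j) = k i.
Proof.
by apply: (coord_sum_free (X := in_tuple Delta)); apply: basis_free hb.
Qed.

Lemma cone_coordP v : cone Delta v <-> forall i, 0 <= co i v.
Proof.
split=> [[c c0 ->] i|h].
  rewrite (big_nth 0) big_mkord coord_lincomb; apply: c0.
  exact: mem_nth.
exists (fun a : V => \sum_(i : 'I_(size Delta) | Delta`_i == a) co i v).
  by move=> a _; apply: sumr_ge0.
rewrite [LHS]coord_sumE (big_nth 0) big_mkord; apply: eq_bigr => i _.
rewrite (big_pred1 i) // => j /=.
rewrite nth_uniq //; exact: free_uniq (basis_free hb).
Qed.

Lemma coneD u v : cone Delta u -> cone Delta v -> cone Delta (u + v).
Proof.
move=> /cone_coordP hu /cone_coordP hv; apply/cone_coordP => i.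
by rewrite linearD addr_ge0 //; [apply: hu|apply: hv].
Qed.

Lemma coneZ c v : 0 <= c -> cone Delta v -> cone Delta (c *: v).
Proof.
move=> c0 /cone_coordP hv; apply/cone_coordP => i.
by rewrite linearZ mulr_ge0 //; apply: hv.
Qed.

Lemma simple_index a : a \in Delta -> exists i, a = Delta`_i.
Proof.
move=> aD; have h := aD; rewrite -index_mem in h.
by exists (Ordinal h); rewrite /= nth_index.
Qed.

Lemma cone_simple a : a \in Delta -> cone Delta a.
Proof.
move=> /simple_index[j ->]; apply/cone_coordP => i.
by rewrite coord_simple ler0n.
Qed.

Lemma cone_antisym v : cone Delta v -> cone Delta (- v) -> v = 0.
Proof.
move=> /cone_coordP h1 /cone_coordP h2; apply: coord_inj => i.
apply/eqP; rewrite linear0 eq_le h1 andbT -oppr_ge0.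
by have := h2 i; rewrite linearN.
Qed.

Lemma height_simple i : height Delta Delta`_i = 1.
Proof.
rewrite /height (bigD1 i) //= coord_simple eqxx big1 ?addr0 // => j ji.
by rewrite coord_simple (negbTE ji).
Qed.

Lemma cone_height0 v : cone Delta v -> height Delta v = 0 -> v = 0.
Proof.
move=> /cone_coordP h /eqP; rewrite psumr_eq0 // => /allP e.
by apply: coord_inj => i; rewrite linear0; apply/eqP/e; rewrite mem_index_enum.
Qed.

Lemma height_ge0 v : cone Delta v -> 0 <= height Delta v.
Proof. by move=> /cone_coordP h; apply: sumr_ge0. Qed.

Lemma heightD u v : height Delta (u + v) = height Delta u + height Delta v.
Proof.
by rewrite /height -big_split /=; apply: eq_bigr => i _; rewrite linearD.
Qed.
Lemma heightZ c v : height Delta (c *: v) = c * height Delta v.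
Proof.
by rewrite /height big_distrr /=; apply: eq_bigr => i _; rewrite linearZ.
Qed.
Lemma heightN v : height Delta (- v) = - height Delta v.
Proof. by rewrite -scaleN1r heightZ mulN1r. Qed.

Lemma normalizeZ c v : c != 0 -> normalize Delta (c *: v) = normalize Delta v.
Proof.
by move=> c0; rewrite /normalize heightZ scalerA invfM mulrAC mulVf ?mul1r.
Qed.
Lemma normalizeN v : normalize Delta (- v) = normalize Delta v.
Proof. by rewrite -scaleN1r normalizeZ // oppr_eq0 oner_eq0. Qed.
End Coordinates.

(** * Roots are positive or negative *)

Section Roots.
Variables (R : realType) (V : vectType R) (B : {symmetric V}) (Delta : seq V).
Hypothesis hD : simple_system B Delta.
Hypothesis hb : basis_of fullv Delta.
Implicit Types (a r : V) (w : seq V).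
Local Notation co := (coord (in_tuple Delta)).
Local Notation act := (act B).
Local Notation s := (reflection B).

Lemma simple_word_unit w : {subset w <= Delta} -> unit_word B w.
Proof. by move=> h a /h; apply: simple_norm hD a. Qed.

Definition reduced_word w := {subset w <= Delta} /\
  forall u : seq V, {subset u <= Delta} -> act u = act w -> (size w <= size u)%N.

Lemma ex_reduced_word w : {subset w <= Delta} ->
  exists2 u, reduced_word u & act u = act w.
Proof.
have [n] := ubnP (size w); elim: n w => // n IH w sw wD.
have [[u [uD uE lt]]|no] := pselect
    (exists u : seq V, [/\ {subset u <= Delta}, act u = act w &
                           (size u < size w)%N]).
  have [|//|u' h1 h2] := IH u; first by rewrite (leq_trans lt).
  by exists u'; rewrite // h2.
exists w => //; split=> // u uD uE; rewrite leqNgt; apply/negP => lt.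
by apply: no; exists u.
Qed.

Lemma subset_rcons w a : {subset w <= Delta} -> a \in Delta ->
  {subset rcons w a <= Delta}.
Proof. by move=> wD aD x; rewrite mem_rcons in_cons => /orP[/eqP->|/wD]. Qed.

Lemma subset_cat w1 w2 : {subset w1 <= Delta} -> {subset w2 <= Delta} ->
  {subset w1 ++ w2 <= Delta}.
Proof. by move=> h1 h2 x; rewrite mem_cat => /orP[/h1|/h2]. Qed.

Lemma subset_pair w a t : a \in Delta -> t \in Delta ->
  (forall z, z \in w -> z = a \/ z = t) -> {subset w <= Delta}.
Proof. by move=> aD tD h z /h[] ->. Qed.

(** If w is reduced and ends in t <> a, write w = v j with j in the dihedral
    group of a and t and v as short as possible. Then v sends a and t into the
    cone by induction, and j sends a to a nonnegative combination of a and t: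
    otherwise w a would be shorter than w. *)
Lemma positivity w a : reduced_word w -> a \in Delta ->
  (forall u : seq V, {subset u <= Delta} -> act u = act (rcons w a) ->
     (size w <= size u)%N) ->
  cone Delta (act w a).
Proof.
have [n] := ubnP (size w); elim: n w a => // n IH w a sw [wD wmin] aD wa.
have a1 := simple_norm hD aD.
case/lastP: w sw wD wmin wa => [|w0 t] sw wD wmin wa.
  by rewrite act_nil; apply: cone_simple.
set w := rcons w0 t in sw wD wmin wa *.
have tD : t \in Delta by apply: wD; rewrite mem_rcons mem_head.
have t1 := simple_norm hD tD.
have w0D : {subset w0 <= Delta}.
  by move=> x xw; apply: wD; rewrite mem_rcons in_cons xw orbT.
have [ta|ta] := eqVneq t a.
  exfalso; have := wa w0 w0D; rewrite size_rcons ltnn.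
  have -> : act w0 = act (rcons w a).
    by apply/lfunP => v; rewrite /w ta act_rcons2.
  by move=> /(_ erefl).
pose dec k := exists v j : seq V, [/\ {subset v <= Delta},
  forall z, z \in j -> z = a \/ z = t, act (v ++ j) = act w,
  (size v + size j <= size w)%N & size v = k].
have dec0 : dec (size w0).
  exists w0, [:: t]; split=> //; first by move=> z; rewrite inE => /eqP; right.
  - by rewrite cats1.
  - by rewrite size_rcons addn1.
have [k [[v [j [vD jat wE sz vk]]] kmin]] :
    exists k, dec k /\ forall k', dec k' -> (k <= k')%N.
  have ex : exists k, `[< dec k >] by exists (size w0); apply/asboolP.
  exists (ex_minn ex); case: ex_minnP => k /asboolP h1 h2; split=> // k' h.
  by apply: h2; apply/asboolP.
have jD : {subset j <= Delta} by apply: subset_pair jat.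
have kw0 : (k <= size w0)%N by apply: kmin.
have szE : (size v + size j = size w)%N.
  apply/eqP; rewrite eqn_leq sz /= -size_cat; apply: wmin => //.
  exact: subset_cat.
have vred : reduced_word v.
  split=> // u uD uE; rewrite -(leq_add2r (size j)) szE -size_cat.
  apply: wmin; first exact: subset_cat.
  by rewrite -wE; apply/lfunP => y; rewrite !act_cat uE.
have vpos p : p = a \/ p = t -> cone Delta (act v p).
  move=> pat; have pD : p \in Delta by case: pat => ->.
  have p1 := simple_norm hD pD.
  apply: IH => //.
    by rewrite vk (leq_ltn_trans kw0) //; move: sw; rewrite size_rcons ltnS.
  move=> u uD uE; rewrite leqNgt; apply/negP => lt.
  have : dec (size u).
    exists u, (p :: j); split=> //.
    - by move=> z; rewrite in_cons => /orP[/eqP->|/jat].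
    - rewrite -wE; apply/lfunP => y.
      by rewrite !act_cat act_cons uE act_rcons reflection_invol.
    - by rewrite -szE /= addnS -addSn leq_add2r.
  by move=> /kmin; rewrite -vk leqNgt lt.
have ha : cone Delta (act v a) by apply: vpos; left.
have ht : cone Delta (act v t) by apply: vpos; right.
rewrite -wE act_cat.
have ta' : a != t by rewrite eq_sym.
have [[x [y [x0 y0 ->]]]|[u [su uE uat]]] :=
    dihedral_positivity a1 t1 (simple_form hD aD tD ta') jat.
  by rewrite actD !actZ; apply: coneD => //; apply: coneZ.
exfalso.
have uD : {subset u <= Delta} by apply: subset_pair uat.
have := wa (v ++ u) (subset_cat vD uD).
rewrite size_cat -szE leq_add2l leqNgt su /= => h; suff: false by [].
apply: h.
by apply/lfunP => y; rewrite act_cat uE act_rcons act_rcons -wE act_cat.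
Qed.

(** If w s_a is shorter than w, positivity applies to w s_a, which sends a to the
    opposite root. *)
Lemma act_simple_sign w a : {subset w <= Delta} -> a \in Delta ->
  cone Delta (act w a) \/ cone Delta (- act w a).
Proof.
move=> wD aD; have a1 := simple_norm hD aD.
have [u [uD umin] uE] := ex_reduced_word wD; rewrite -uE.
have [h|] := pselect (forall u' : seq V, {subset u' <= Delta} ->
    act u' = act (rcons u a) -> (size u <= size u')%N).
  by left; apply: positivity.
move=> /existsNP[u' /not_implyP[u'D /not_implyP[u'E /negP]]].
rewrite -ltnNge => lt; right.
have [z [zD zmin] zE] := ex_reduced_word u'D.
have zlt : (size z < size u)%N by apply: leq_ltn_trans lt; apply: zmin.
suff -> : - act u a = act z a.
  apply: positivity => // y yD yE.
  have : (size u <= size y)%N.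
    apply: umin => //; rewrite yE; apply/lfunP => p.
    by rewrite act_rcons zE u'E act_rcons reflection_invol.
  by apply: leq_trans; rewrite ltnW.
by rewrite zE u'E act_rcons reflection_root // actN.
Qed.

(** A nonempty reduced word sends its last letter to minus the cone. *)
Lemma positive_word_trivial w : {subset w <= Delta} ->
  (forall a, a \in Delta -> cone Delta (act w a)) -> forall v, act w v = v.
Proof.
move=> wD h v; have [u [uD umin] uE] := ex_reduced_word wD.
rewrite -uE in h *.
case/lastP: u uD umin {uE} h => [|u t] uD umin h; first by rewrite act_nil.
exfalso.
have tD : t \in Delta by apply: uD; rewrite mem_rcons mem_head.
have t1 := simple_norm hD tD.
have u0D : {subset u <= Delta}.
  by move=> x xw; apply: uD; rewrite mem_rcons in_cons xw orbT.
have ured : reduced_word u.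
  split=> // y yD yE; rewrite -ltnS -(size_rcons u t) -(size_rcons y t).
  apply: umin; first exact: subset_rcons.
  by apply/lfunP => p; rewrite !act_rcons yE.
have pos : cone Delta (act u t).
  apply: positivity => // y yD yE.
  by rewrite (leq_trans _ (umin y yD yE)) // size_rcons.
have neg := h t tD.
rewrite act_rcons reflection_root // actN in neg.
have z : act u t = 0 by apply: cone_antisym pos neg.
have := act_isometry t t (simple_word_unit u0D).
by rewrite z linear0r t1 => /eqP; rewrite eq_sym oner_eq0.
Qed.
End Roots.

Section Pigeonhole.

Lemma pigeonhole (T : Type) (F : finType) (A : set T) (f : T -> F) :
  infinite_set A -> exists x y, [/\ A x, A y, x <> y & f x = f y].
Proof.
move=> infA; apply: contrapT => no; apply: infA.
have finj : {in A &, injective f}.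
  move=> x y /set_mem Ax /set_mem Ay fxy; apply: contrapT => xy.
  by apply: no; exists x, y.
by rewrite -(eq_finite_set (inj_card_eq finj)); apply: finite_finset.
Qed.
End Pigeonhole.

Section GeneratedSubgroups.
Variables (R : realType) (V : vectType R) (B : {symmetric V}).
Implicit Types (f g : 'End(V)) (X : set 'End(V)).

Lemma generated_mem X f : X f -> generated_by B X f.
Proof. exact: sub_gen_smallest. Qed.

Lemma generated_id X : generated_by B X \1%VF.
Proof. by move=> G [[_ ? _ _] _]. Qed.

Lemma generated_comp X f g :
  generated_by B X f -> generated_by B X g -> generated_by B X (f \o g)%VF.
Proof.
move=> hf hg G [sG XG]; case: (sG) => _ _ mul _.
by apply: mul; [apply: hf|apply: hg].
Qed.
End GeneratedSubgroups.

(** * The root system *)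

Section RootSystem.
Variables (R : realType) (V : vectType R) (B : {symmetric V}) (Phi : set V)
  (Delta : seq V).
Hypothesis hPhi : based_root_system B Phi Delta.
Hypothesis hb : basis_of fullv Delta.
Implicit Types (a u v r : V) (w : seq V).
Local Notation co := (coord (in_tuple Delta)).
Local Notation act := (act B).
Local Notation s := (reflection B).

Let hD : simple_system B Delta := hPhi.1.

Lemma weyl_group_words :
  weyl_group B Delta = [set act w | w in [set w : seq V | {subset w <= Delta}]].
Proof.
have unitw w : {subset w <= Delta} -> unit_word B w by apply: simple_word_unit.
apply/seteqP; split.
  apply: smallest_sub => [|f /= [a aD <-]]; last first.
    exists [:: a]; first by move=> x; rewrite inE => /eqP ->.
    by rewrite /= comp_lfun1r.
  have ker0 w : {subset w <= Delta} -> lker (act w) == 0%VS.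
    by move=> /unitw h; apply/lker0P/(can_inj (fun v => act_revK v h)).
  split.
  - move=> f [w wD <-]; split; first exact/eqP/ker0.
    by move=> x y; apply: act_isometry; apply: unitw.
  - by exists [::].
  - move=> f g [w wD <-] [w' w'D <-]; exists (w ++ w'); first exact: subset_cat.
    by apply/lfunP => v; rewrite comp_lfunE act_cat.
  - move=> f [w wD <-]; exists (rev w).
      by move=> x; rewrite mem_rev; apply: wD.
    apply/lfunP => v; apply: (can_inj (lker0_lfunK (ker0 w wD))).
    by rewrite lker0_lfunVK ?ker0 // act_Krev //; apply: unitw.
move=> f [w wD <-]; elim: w wD => [|a w IH] wD; first exact: generated_id.
apply: generated_comp; last first.
  by apply: IH => x xw; apply: wD; rewrite in_cons xw orbT.
by apply: generated_mem; exists a => //; apply: wD; rewrite mem_head.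
Qed.

Lemma rootP r :
  Phi r <-> exists w a, [/\ {subset w <= Delta}, a \in Delta & r = act w a].
Proof.
rewrite hPhi.2 weyl_group_words; split.
  by move=> [_ [w wD <-] [a aD <-]]; exists w, a.
by move=> [w [a [wD aD ->]]]; exists (act w); [exists w|exists a].
Qed.

Lemma simple_root a : a \in Delta -> Phi a.
Proof. by move=> aD; apply/rootP; exists [::], a; rewrite act_nil. Qed.

Lemma root_unit r : Phi r -> B r r = 1.
Proof.
move=> /rootP[w [a [wD aD ->]]].
by rewrite act_isometry ?(simple_norm hD) //; apply: simple_word_unit hD _ wD.
Qed.

Lemma root_reflection_word r : Phi r ->
  exists2 w, {subset w <= Delta} & s r = act w.
Proof.
move=> /rootP[w [a [wD aD ->]]]; exists (w ++ a :: rev w).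
  move=> x; rewrite mem_cat in_cons mem_rev.
  by case/or3P => [/wD|/eqP->|/wD].
by rewrite act_reflection //; apply: simple_word_unit hD _ wD.
Qed.

Lemma act_root w r : {subset w <= Delta} -> Phi r -> Phi (act w r).
Proof.
move=> wD /rootP[w' [a [w'D aD ->]]]; apply/rootP; exists (w ++ w'), a.
by rewrite act_cat; split=> //; apply: subset_cat.
Qed.

Lemma reflection_closed r r' : Phi r -> Phi r' -> Phi (s r r').
Proof.
by move=> /root_reflection_word[w wD ->] hr'; apply: act_root.
Qed.

Lemma rootN r : Phi r -> Phi (- r).
Proof.
by move=> hr; rewrite -(reflection_root (root_unit hr)); apply: reflection_closed.
Qed.

Lemma root_sign r : Phi r -> cone Delta r \/ cone Delta (- r).
Proof. by move=> /rootP[w [a [wD aD ->]]]; apply: (act_simple_sign hD hb). Qed.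

Lemma root_neq0 r : Phi r -> r != 0.
Proof.
move=> /root_unit h; apply/eqP => r0; move: h.
by rewrite r0 linear0r => /eqP; rewrite eq_sym oner_eq0.
Qed.

Lemma pos_root_height r : Phi r -> cone Delta r -> 0 < height Delta r.
Proof.
move=> hr cr; rewrite lt_neqAle height_ge0 // andbT eq_sym.
by apply: contra (root_neq0 hr) => /eqP h; apply/eqP; apply: (cone_height0 hb).
Qed.

Lemma root_height r : Phi r -> height Delta r != 0.
Proof.
move=> hr; have [h|h] := root_sign hr; first by rewrite gt_eqF // pos_root_height.
by rewrite -oppr_eq0 -heightN // gt_eqF // pos_root_height //; apply: rootN.
Qed.

(** As both roots have norm 1, c is 1 or -1, and -1 would give r' a negative
    height. *)
Lemma pos_root_prop r r' c : Phi r -> Phi r' -> cone Delta r -> cone Delta r' ->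
  r' = c *: r -> r' = r.
Proof.
move=> hr hr' cr cr' e.
have := root_unit hr'; rewrite e !formE (root_unit hr) mulr1 -expr2 => c2.
have : (c - 1) * (c + 1) = 0 by rewrite -subr_sqr expr1n c2 subrr.
move/eqP; rewrite mulf_eq0 subr_eq0 addr_eq0 => /orP[] /eqP ce.
  by rewrite ce scale1r.
have := pos_root_height hr' cr'; rewrite e heightZ // ce mulN1r oppr_gt0.
by rewrite ltNge ltW // pos_root_height.
Qed.

(** A positive root other than a has a positive coordinate off a, which the
    reflection in a does not change. *)
Lemma simple_reflection_pos a r : a \in Delta -> Phi r -> cone Delta r ->
  r <> a -> cone Delta (s a r).
Proof.
move=> aD hr cr ra; have pa := simple_root aD.
have [//|neg] := root_sign (reflection_closed pa hr).
exfalso; apply: ra; apply: (@pos_root_prop a r (height Delta r)) => //.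
  exact: cone_simple.
have [i ai] := simple_index aD.
have h0 j : j != i -> co j r = 0.
  move=> ji; apply/eqP; rewrite eq_le.
  have /(cone_coordP hb)/(_ j) := cr; move=> ->; rewrite andbT.
  have /(cone_coordP hb)/(_ j) := neg.
  rewrite unit_reflectionE ?(simple_norm hD) // opprB linearB linearZ /=.
  by rewrite ai coord_simple // (negbTE ji) mulr0 sub0r oppr_ge0.
have hi : height Delta r = co i r.
  by rewrite /height (bigD1 i) //= big1 ?addr0.
rewrite [LHS](coord_sumE hb) (bigD1 i) //= big1 ?addr0 ?hi ?ai //.
by move=> j ji; rewrite h0 // scale0r.
Qed.

(** * Finitely many positive roots of bounded height *)

Definition coord_norm v : R := \sum_i `|co i v|.
Local Notation N := coord_norm.

Lemma coord_normD u v : N (u + v) <= N u + N v.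
Proof.
rewrite /N -big_split /=; apply: ler_sum => i _.
by rewrite linearD ler_normD.
Qed.

Lemma coord_normZ c v : N (c *: v) = `|c| * N v.
Proof.
by rewrite /N big_distrr /=; apply: eq_bigr => i _; rewrite linearZ normrM.
Qed.

Lemma coord_norm_ge0 v : 0 <= N v.
Proof. by apply: sumr_ge0. Qed.

Lemma coord_norm_cone v : cone Delta v -> N v = height Delta v.
Proof.
move=> /(cone_coordP hb) h; apply: eq_bigr => i _.
by rewrite ger0_norm //; apply: h.
Qed.

Lemma coord_le_norm i v : `|co i v| <= N v.
Proof. by rewrite /N (bigD1 i) //= lerDl; apply: sumr_ge0. Qed.

Definition form_norm : R :=
  \sum_(i < size Delta) \sum_(j < size Delta) `|B Delta`_i Delta`_j|.

Lemma form_norm_ge0 : 0 <= form_norm.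
Proof. by apply: sumr_ge0 => i _; apply: sumr_ge0. Qed.

Lemma form_bound u v : `|B u v| <= form_norm * N u * N v.
Proof.
rewrite {1}[u](coord_sumE hb) form_suml.
apply: le_trans (ler_norm_sum _ _ _) _.
have Bij i j : `|B Delta`_(i : 'I_(size Delta)) Delta`_(j : 'I_(size Delta))|
    <= form_norm.
  rewrite /form_norm (bigD1 i) //= (bigD1 j) //= -addrA lerDl.
  by apply: addr_ge0; apply: sumr_ge0 => // k _; apply: sumr_ge0.
have h i : `|B (co i u *: Delta`_i) v| <= `|co i u| * (form_norm * N v).
  rewrite formZl normrM ler_wpM2l // {1}[v](coord_sumE hb) form_sumr.
  apply: le_trans (ler_norm_sum _ _ _) _.
  rewrite mulr_sumr; apply: ler_sum => j _.
  by rewrite formZr normrM mulrC ler_wpM2r.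
apply: le_trans (ler_sum _ (fun i _ => h i)) _.
by rewrite -mulr_suml mulrC mulrAC.
Qed.

(** If the positive roots r and r' of height at most M are close, then
    s_r s_r' moves every simple root so little that it stays positive; hence
    s_r s_r' = 1, and r = r'. *)
Lemma close_roots_eq (M : R) : 0 <= M -> exists2 e : R, 0 < e &
  forall r r', Phi r -> Phi r' -> cone Delta r -> cone Delta r' ->
    height Delta r <= M -> height Delta r' <= M -> N (r' - r) <= e -> r = r'.
Proof.
move=> M0; pose K := form_norm; have K0 : 0 <= K := form_norm_ge0.
(* C * e bounds how far s_r s_r' moves a simple root. *)
pose C := 4 * K * M * (1 + 2 * K * M ^+ 2).
have C0 : 0 <= C by rewrite !mulr_ge0 // addr_ge0 // !mulr_ge0 // exprn_ge0.
have C1 : 0 < 1 + C by lra.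
exists (1 + C)^-1; first by rewrite invr_gt0.
move=> r r' hr hr' cr cr' rM r'M; set e := _^-1 => dre.
have e0 : 0 < e by rewrite invr_gt0.
have Ce : C * e < 1.
  have : (1 + C) * e = 1 by rewrite divff // gt_eqF.
  nra.
have r1 := root_unit hr; have r'1 := root_unit hr'.
have Nr : N r <= M by rewrite coord_norm_cone.
have Nr' : N r' <= M by rewrite coord_norm_cone.
have Nr0 := coord_norm_ge0 r; have Nr'0 := coord_norm_ge0 r'.
set d := r' - r in dre; have Nd0 := coord_norm_ge0 d.
have [w wD wE] := root_reflection_word hr.
have [w' w'D w'E] := root_reflection_word hr'.
have refl_bound y : N (s r y) <= N y * (1 + 2 * K * M ^+ 2).
  rewrite unit_reflectionE // -scaleNr; apply: le_trans (coord_normD _ _) _.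
  rewrite coord_normZ normrN normrM (ger0_norm (_ : 0 <= 2)) //.
  have := form_bound r y; rewrite -/K => hy.
  have Ny := coord_norm_ge0 y.
  have h1 : `|B r y| <= K * M * N y.
    by apply: le_trans hy _; rewrite ler_wpM2r // ler_wpM2l.
  have h2 : `|B r y| * N r <= K * M * N y * M by rewrite ler_pM.
  rewrite expr2; nra.
have moved (i : 'I_(size Delta)) : N (s r (s r' Delta`_i) - Delta`_i) < 1.
  set a := Delta`_i.
  have Na : N a = 1.
    rewrite coord_norm_cone; first exact: height_simple.
    by apply: cone_simple => //; apply: mem_nth.
  set y := - 2 *: (B d a *: r' + B r a *: d).
  have -> : s r (s r' a) - a = s r y.
    have -> : s r' a = s r a + y.
      apply: (coord_inj hb) => j.
      rewrite !unit_reflectionE // /y /d formBl.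
      by rewrite !coordinateE; ring.
    by rewrite linearD /= reflection_invol // addrAC subrr add0r.
  apply: le_lt_trans (refl_bound y) _.
  have Ny : N y <= 4 * K * M * e.
    rewrite /y coord_normZ normrN ger0_norm //.
    have t1 := coord_normD (B d a *: r') (B r a *: d).
    rewrite !coord_normZ in t1.
    have := form_bound d a; have := form_bound r a; rewrite Na !mulr1 -/K.
    move=> b1 b2.
    have c1 : `|B d a| * N r' <= K * e * M.
      apply: ler_pM => //; apply: le_trans b2 _; rewrite ler_wpM2l //.
    have c2 : `|B r a| * N d <= K * M * e.
      apply: ler_pM => //; apply: le_trans b1 _; rewrite ler_wpM2l //.
    nra.
  apply: le_lt_trans Ce; rewrite /C [leRHS]mulrAC; apply: ler_wpM2r => //.
  by rewrite addr_ge0 // !mulr_ge0 // exprn_ge0.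
have triv : forall v, act (w ++ w') v = v.
  apply: (positive_word_trivial hD hb); first exact: subset_cat.
  move=> a /[dup] aD /simple_index[i ai]; rewrite ai in aD *.
  have [//|neg] := act_simple_sign hD hb (subset_cat wD w'D) aD.
  exfalso; have := moved i; rewrite wE w'E -act_cat ltNge => /negP; apply.
  apply: le_trans (coord_le_norm i _).
  have /(cone_coordP hb)/(_ i) := neg; rewrite linearN linearB /= => h.
  rewrite coord_simple // eqxx /=.
  rewrite ler0_norm; lra.
have sE : s r r' = - r'.
  have := triv r'; rewrite act_cat -w'E -wE reflection_root // linearN => e'.
  by rewrite -[in RHS]e' opprK.
apply/esym; apply: (@pos_root_prop r r' (B r r')) => //.
move: sE; rewrite unit_reflectionE // => /eqP.
rewrite subr_eq addrC -subr_eq opprK.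
rewrite -mulr2n -scaler_nat => /eqP e2.
by apply: (@scalerI _ _ 2) => //; rewrite e2 scalerA.
Qed.

(** Infinitely many roots in a bounded box would include two in the same cell
    of a grid, hence arbitrarily close to each other. *)
Lemma finite_low_roots (M : R) :
  finite_set [set r | [/\ Phi r, cone Delta r & height Delta r <= M]].
Proof.
apply: contrapT => inf.
have [r0 [hr0 cr0 r0M]] := infinite_setN0 inf.
have M0 : 0 <= M := le_trans (height_ge0 hb cr0) r0M.
have [e e0 he] := close_roots_eq M0.
(* Cells of side 1 / n have diameter at most d / n <= e. *)
set d := size Delta; pose n := (Num.truncn (d%:R / e)).+1.
have n0 : 0 < n%:R :> R by rewrite ltr0n.
pose f r := [ffun i : 'I_d => inord (Num.truncn (co i r * n%:R)) :
  'I_(Num.truncn (M * n%:R)).+1].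
have [x [y [[hx cx xM] [hy cy yM] xy fxy]]] := pigeonhole f inf.
apply: xy; apply: he => //.
have coM z i : cone Delta z -> height Delta z <= M ->
    0 <= co i z * n%:R <= M * n%:R.
  move=> cz zM; have z0 : 0 <= co i z by move/(cone_coordP hb): cz.
  rewrite mulr_ge0 //= ler_pM2r //; apply: le_trans zM.
  by rewrite -coord_norm_cone // (le_trans _ (coord_le_norm i z)) // ler_norm.
have close i : `|co i (y - x)| <= n%:R^-1.
  have /ffunP/(_ i) := fxy; rewrite !ffunE => /(congr1 val) /=.
  have [/andP[x0 xm] /andP[y0 ym]] := (coM x i cx xM, coM y i cy yM).
  rewrite !inordK ?ltnS ?le_truncn // => tE.
  have := truncn_itv x0; have := truncn_itv y0; rewrite tE -natr1.
  move=> /andP[hy1 hy2] /andP[hx1 hx2].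
  rewrite coord_is_sub -(ler_pM2r n0) mulVf ?gt_eqF //.
  rewrite -[X in _ * X](ger0_norm (ltW n0)) -normrM mulrBl ler_norml.
  by apply/andP; split; lra.
apply: le_trans (ler_sum _ (fun i _ => close i)) _.
rewrite sumr_const card_ord -[_ *+ size _]mulr_natl ler_pdivrMr //.
rewrite mulrC -ler_pdivrMr //.
by apply: ltW; apply: truncnS_gt.
Qed.
End RootSystem.

(** * Convergence in coordinates *)

Lemma cvg_seq_sum (R : realType) (W : normedModType R) (I : Type) (r : seq I)
    (f : I -> nat -> W) (l : I -> W) :
  (forall i, f i @ \oo --> l i) ->
  (fun n => \sum_(i <- r) f i n) @ \oo --> \sum_(i <- r) l i.
Proof.
move=> h; elim: r => [|i r IH].
  rewrite big_nil (_ : (fun n => _) = cst 0); first exact: cvg_cst.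
  by apply/funext => n; rewrite big_nil.
rewrite big_cons (_ : (fun n => _) = f i \+ (fun n => \sum_(i <- r) f i n)).
  by apply: cvgD.
by apply/funext => n; rewrite big_cons.
Qed.

Section CoordinateTopology.
Variables (R : realType) (V : vectType R) (Delta : seq V).
Hypothesis hb : basis_of fullv Delta.
Implicit Types (v : V) (x : vtop V).
Local Notation co := (coord (in_tuple Delta)).
Local Notation v2r := (@VectorInternalTheory.v2r R V).
Local Notation b2mx := (VectorInternalTheory.b2mx (vT := V)).

Lemma v2rD u v : v2r (u + v) = v2r u + v2r v.
Proof.
by have [_ /(_ u v)] := v2r_semilinear (VectorInternalTheory.v2r_subproof V).
Qed.

Lemma v2rZ (c : R) v : v2r (c *: v) = c *: v2r v.
Proof.
by have [/(_ c v)] := v2r_semilinear (VectorInternalTheory.v2r_subproof V).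
Qed.

Lemma v2r0 : v2r 0 = 0.
Proof. by rewrite -(scale0r (0 : V)) v2rZ scale0r. Qed.

Lemma vtop_cvg_coord (u : nat -> vtop V) x i :
  u @ \oo --> x -> (fun n => co i (u n : V)) @ \oo --> co i (x : V).
Proof.
move=> ux.
have vx : (fun n => v2r (u n)) @ \oo --> v2r x.
  apply: (cvg_comp _ _ ux); exact: (@initial_continuous _ _ v2r).
have coE v : co i v = \sum_j v2r v 0 j * pinvmx (b2mx (in_tuple Delta)) j i.
  by rewrite unlock /coord_expanded_def mxE.
rewrite coE (_ : (fun n => _) =
    (fun n => \sum_j v2r (u n) 0 j * pinvmx (b2mx (in_tuple Delta)) j i));
  last first.
  by apply/funext => n; rewrite coE.
apply: (@cvg_seq_sum R R^o _ _
  (fun j n => v2r (u n) 0 j * pinvmx (b2mx (in_tuple Delta)) j i)) => j.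
have h : (fun n => v2r (u n) 0 j) @ \oo --> v2r x 0 j.
  apply: (@cvg_comp _ _ _ (fun n => v2r (u n))
    (fun M : 'rV[R]_(dim V) => M 0 j) _ _ _ vx).
  exact: (@coord_continuous R 1 _ 0 j).
exact: (@cvgMr_tmp R _ _ _ _ _ _ h).
Qed.

Lemma coord_cvg_vtop (u : nat -> vtop V) x :
  (forall i, (fun n => co i (u n : V)) @ \oo --> co i (x : V)) ->
  u @ \oo --> x.
Proof.
move=> h.
have vE v : v2r v = \sum_i co i v *: v2r Delta`_i.
  rewrite {1}[v](coord_sumE hb). rewrite (big_morph _ v2rD v2r0).
  by apply: eq_bigr => i _; rewrite v2rZ.
have vx : (fun n => v2r (u n)) @ \oo --> v2r x.
  rewrite vE (_ : (fun n => _) =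
    (fun n => \sum_i co i (u n : V) *: v2r Delta`_i)); last first.
    by apply/funext => n; rewrite vE.
  apply: (@cvg_seq_sum R _ _ _
    (fun j n => co j (u n : V) *: v2r Delta`_j)) => j.
  exact: cvgZr_tmp.
move=> A [_ [[C oC <-] Cx] CA].
have : nbhs (v2r x) C by exact: (open_nbhs_nbhs (conj oC Cx)).
move=> /vx [m _ hm]; exists m => // n mn; apply: CA; exact: hm.
Qed.
End CoordinateTopology.

Section NormalizationLimits.
Variables (R : realType) (V : vectType R) (Delta : seq V).
Hypothesis hb : basis_of fullv Delta.
Local Notation co := (coord (in_tuple Delta)).

Lemma cvg_height (u : nat -> vtop V) (x : vtop V) : u @ \oo --> x ->
  (fun n => height Delta (u n)) @ \oo --> height Delta x.
Proof.
move=> ux; apply: (@cvg_seq_sum R R^o _ _ (fun i n => co i (u n : V))) => i.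
exact: vtop_cvg_coord.
Qed.

Lemma cvg_normalize (u : nat -> vtop V) (x : vtop V) : u @ \oo --> x ->
  height Delta x != 0 ->
  (fun n => normalize Delta (u n) : vtop V) @ \oo -->
    (normalize Delta x : vtop V).
Proof.
move=> ux hx; apply: (coord_cvg_vtop hb) => i.
rewrite coord_is_scale (_ : (fun n => _) =
  (fun n => (height Delta (u n))^-1) \* (fun n => co i (u n : V))).
  by apply: cvgM; [apply: cvgV hx (cvg_height ux)|apply: vtop_cvg_coord].
by apply/funext => n; rewrite coord_is_scale.
Qed.

Lemma cvg_addZ (u : nat -> vtop V) (x : vtop V) (e : nat -> R) (l : R) (z : V) :
  u @ \oo --> x -> e @ \oo --> l ->
  (fun n => (u n : V) + e n *: z : vtop V) @ \oo --> ((x : V) + l *: z : vtop V).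
Proof.
move=> ux el; apply: (coord_cvg_vtop hb) => i.
rewrite coord_is_add coord_is_scale (_ : (fun n => _) =
  (fun n => co i (u n : V)) \+ (fun n => e n * co i z)).
  by apply: cvgD; [apply: vtop_cvg_coord|apply: (@cvgMr_tmp R)].
by apply/funext => n; rewrite coord_is_add coord_is_scale.
Qed.
End NormalizationLimits.

(** * Limit roots of dihedral subgroups *)

Section DihedralLimits.
Variables (R : realType) (V : vectType R) (B : {symmetric V}) (Phi : set V)
  (Delta : seq V).
Hypothesis hPhi : based_root_system B Phi Delta.
Hypothesis hb : basis_of fullv Delta.
Implicit Types (r : V).
Local Notation s := (reflection B).
Local Notation G r1 r2 := (generated_by B [set s r1; s r2]).

Lemma dihedral_root_mem r1 r2 k : Phi r1 -> Phi r2 ->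
  dihedral_roots B Phi r1 r2 (dihedral_root B r1 r2 k).
Proof.
move=> h1 h2; have [u1 u2] := (root_unit hPhi h1, root_unit hPhi h2).
have g1 : G r1 r2 (s r1) by apply: generated_mem; left.
have g2 : G r1 r2 (s r2) by apply: generated_mem; right.
have step a r : Phi a -> G r1 r2 (s a) -> dihedral_roots B Phi r1 r2 r ->
    dihedral_roots B Phi r1 r2 (s a r).
  move=> ha ga [hr gr]; split; first exact: (reflection_closed hPhi).
  have a1 := root_unit hPhi ha.
  have -> : s (s a r) = (s a \o (s r \o s a))%VF.
    have iso x y : B (s a x) (s a y) = B x y by apply: reflection_isometry.
    apply/lfunP => v; rewrite !comp_lfunE -(reflection_conj r (s a v) iso).
    by rewrite reflection_invol.
  by apply: generated_comp => //; apply: generated_comp.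
suff: dihedral_roots B Phi r1 r2 (dihedral_root B r1 r2 k) /\
      dihedral_roots B Phi r1 r2 (dihedral_root B r2 r1 k) by case.
elim: k => [|k [IH1 IH2]]; first by rewrite !dihedral_root0; split; split.
by rewrite -!dihedral_rootS //; split; apply: step.
Qed.

(** The discriminant of the equation in t is 4 (b^2 - 1). *)
Lemma isotropic_form_ge1 (b t : R) : 1 + 2 * t * b + t ^+ 2 = 0 -> 1 <= `|b|.
Proof.
move=> e; rewrite -[1]normr1 -ler_sqr ?nnegrE // !real_normK ?num_real // expr1n.
have tb : 2 * t * b = - (1 + t ^+ 2) by lra.
have t0 : 0 < t ^+ 2.
  rewrite lt_neqAle sqr_ge0 eq_sym andbT sqrf_eq0; apply/eqP => t0.
  by move: e; rewrite t0; lra.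
have h : 4 * t ^+ 2 * b ^+ 2 = (1 + t ^+ 2) ^+ 2.
  by rewrite -[RHS]sqrrN -tb; ring.
have h2 : 0 <= (1 - t ^+ 2) ^+ 2 := sqr_ge0 _.
suff: 4 * t ^+ 2 * 1 <= 4 * t ^+ 2 * b ^+ 2 by rewrite ler_pM2l // mulr_gt0.
by rewrite mulr1 h; move: h2; rewrite !expr2; lra.
Qed.

(** With y = r1 + t r2 isotropic, the dihedral roots are
    cheb c n.+1 *: y - t ^+ n.+1 *: r2 with c = - B r1 r2 and 1 <= `|c|; as
    |cheb c n.+1| > n and |t| <= 1, their directions converge to that of y. *)
Lemma dihedral_limit_le1 r1 r2 (t : R) : Phi r1 -> Phi r2 ->
    cone Delta r1 -> cone Delta r2 -> r1 <> r2 ->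
    1 + 2 * t * B r1 r2 + t ^+ 2 = 0 -> height Delta (r1 + t *: r2) != 0 ->
    `|t| <= 1 ->
  dihedral_limit_roots B Phi Delta (normalize Delta (r1 + t *: r2)).
Proof.
move=> h1 h2 c1 c2 r12 te hy t1; set y := r1 + t *: r2 in hy *.
set c := - B r1 r2.
have c_ge1 : 1 <= `|c| by rewrite normrN; apply: isotropic_form_ge1 te.
have chebE n : cheb c n - t * cheb c n.+1 = - t ^+ n.+1.
  elim: n => [|n IH]; first by rewrite cheb0 cheb1 mulr1 sub0r expr1.
  rewrite chebSS (_ : - t ^+ n.+2 = t * (cheb c n - t * cheb c n.+1)); last first.
    by rewrite IH mulrN exprS.
  set q := cheb c n.+1; set p := cheb c n.
  apply/eqP; rewrite -subr_eq0.
  rewrite (_ : _ - _ = (1 + 2 * t * B r1 r2 + t ^+ 2) * q).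
    by rewrite te mul0r.
  by rewrite /c; ring.
have cheb_neq0 n : cheb c n.+1 != 0.
  by rewrite -normr_gt0; apply: lt_le_trans (cheb_norm_ge _ c_ge1); rewrite ltr0n.
pose e n := - (t ^+ n.+1 / cheb c n.+1).
have dE n : dihedral_root B r1 r2 n = cheb c n.+1 *: (y + e n *: r2).
  rewrite /dihedral_root -/c /y /e; have := chebE n; set p := cheb c n.
  have := cheb_neq0 n; set q := cheb c n.+1 => q0 pE.
  have -> : p = t * q - t ^+ n.+1 by lra.
  rewrite !scalerDr !scalerA -addrA -scalerDl; congr (_ + _ *: _).
  by field.
exists r1, r2; split=> //.
exists (fun n => normalize Delta (dihedral_root B r1 r2 n)); split.
- move=> j k /= jk.
  have hj := dihedral_root_mem j h1 h2; have hk := dihedral_root_mem k h1 h2.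
  set rj := dihedral_root B r1 r2 j in jk hj.
  set rk := dihedral_root B r1 r2 k in jk hk.
  have [hj1 _] := hj; have [hk1 _] := hk.
  (* Equal directions mean equal roots up to sign, and r1, r2 are linearly
     independent. *)
  pose l := height Delta rj / height Delta rk.
  have rjE : rj = l *: rk.
    rewrite -[LHS]scale1r -(divff (root_height hPhi hb hj1)) -scalerA.
    by rewrite -/(normalize Delta rj) jk scalerA.
  have l2 : l ^+ 2 = 1.
    have := root_unit hPhi hj1.
    by rewrite rjE formZl formZr (root_unit hPhi hk1) mulr1 expr2.
  have l1 : `|l| = 1.
    by apply/eqP; rewrite -(eqrXn2 (n := 2)) // -normrX l2 normr1 expr1n.
  apply: (cheb_norm_inj c_ge1); rewrite -[RHS]mul1r -l1 -normrM; congr `|_|.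
  apply/eqP; rewrite -subr_eq0; apply: contra_notT r12 => nz.
  clearbody l; move: rjE; rewrite /rj /rk /dihedral_root -/c => E.
  apply/esym; apply: (@pos_root_prop _ _ _ _ _ hPhi hb r1 r2
    ((l * cheb c k.+1 - cheb c j.+1) / (cheb c j - l * cheb c k))) => //.
  apply: (@scalerI _ _ (cheb c j - l * cheb c k)) => //.
  rewrite scalerA mulrCA divff // mulr1; apply: (coord_inj hb) => i.
  have := congr1 (coord (in_tuple Delta) i) E; rewrite !coordinateE; lra.
- move=> n; exists (dihedral_root B r1 r2 n) => //.
  exact: dihedral_root_mem.
- rewrite (_ : (fun n => _) =
    (fun n => normalize Delta (y + e n *: r2))); last first.
    by apply/funext => n; rewrite dE normalizeZ.
  apply: (@cvg_normalize _ _ _ hb) => //.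
  rewrite -[X in _ --> X]addr0 -(scale0r r2).
  apply: (@cvg_addZ _ _ _ hb); first exact: cvg_cst.
  apply/cvgrPdist_le => d d0.
  near=> n.
  rewrite sub0r opprK normrM normrV ?unitfE // normrX.
  rewrite ler_pdivrMr ?normr_gt0 //.
  apply: (@le_trans _ _ 1); first by rewrite exprn_ile1.
  apply: (@le_trans _ _ (d * n.+1%:R)); last first.
    by rewrite ler_pM2l // cheb_norm_ge.
  rewrite -ler_pdivrMl // mulr1; apply: ltW.
  apply: lt_le_trans (truncnS_gt _) _; rewrite ler_nat ltnS.
  by near: n; exists (Num.truncn d^-1).
Unshelve. all: by end_near. Qed.

(** Exchanging r1 and r2 replaces t by t^-1. *)
Lemma dihedral_limit r1 r2 (t : R) : Phi r1 -> Phi r2 ->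
    cone Delta r1 -> cone Delta r2 -> r1 <> r2 ->
    1 + 2 * t * B r1 r2 + t ^+ 2 = 0 -> height Delta (r1 + t *: r2) != 0 ->
  dihedral_limit_roots B Phi Delta (normalize Delta (r1 + t *: r2)).
Proof.
move=> h1 h2 c1 c2 r12 te hy.
have [t1|t1] := leP `|t| 1; first exact: dihedral_limit_le1.
have t0 : t != 0 by rewrite -normr_gt0 (lt_trans _ t1).
have yE : r1 + t *: r2 = t *: (r2 + t^-1 *: r1).
  by rewrite scalerDr scalerA mulfV // scale1r addrC.
rewrite yE normalizeZ //; apply: dihedral_limit_le1 => //.
- by move/esym.
- apply: (mulfI (_ : t ^+ 2 != 0)); first by rewrite expf_neq0.
  rewrite mulr0 -te (formC B r2); field.
  by [].
- by apply: contraNneq hy => e; rewrite yE heightZ e mulr0.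
- by rewrite normrV ?unitfE // invf_le1 ?(lt_trans _ t1) // ltW.
Qed.
End DihedralLimits.

(** * Limit roots outside the radical *)

Section LimitRoots.
Variables (R : realType) (V : vectType R) (B : {symmetric V}) (Phi : set V)
  (Delta : seq V).
Hypothesis hPhi : based_root_system B Phi Delta.
Hypothesis hb : basis_of fullv Delta.
Implicit Types (r : V).
Local Notation co := (coord (in_tuple Delta)).
Local Notation ht := (height Delta).

Lemma cvg_form (u : nat -> vtop V) (x : vtop V) (a : V) : u @ \oo --> x ->
  (fun n => B a (u n : V)) @ \oo --> B a (x : V).
Proof.
move=> ux.
have E v : B a v = \sum_i co i v * B a Delta`_i.
  rewrite {1}[v](coord_sumE hb) form_sumr; apply: eq_bigr => i _.
  by rewrite formZr.
rewrite E (_ : (fun n => _) =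
  (fun n => \sum_i co i (u n : V) * B a Delta`_i)); last first.
  by apply/funext => n; rewrite E.
apply: (@cvg_seq_sum R R^o _ _ (fun i n => co i (u n : V) * B a Delta`_i)) => i.
by apply: (@cvgMr_tmp R); apply: vtop_cvg_coord.
Qed.

Lemma normalize_height r : ht r != 0 -> ht (normalize Delta r) = 1.
Proof. by move=> h; rewrite heightZ mulVf. Qed.

Lemma positive_representative r : Phi r ->
  exists r', [/\ Phi r', cone Delta r' & normalize Delta r = normalize Delta r'].
Proof.
move=> hr; have [c|c] := root_sign hPhi hb hr; first by exists r.
by exists (- r); rewrite normalizeN; split=> //; apply: (rootN hPhi).
Qed.

Lemma finite_nat_bounded (A : set nat) :
  finite_set A -> exists m, forall n, A n -> (n < m)%N.
Proof.
move=> /finite_seqP[t ->]; exists (\max_(n <- t) n).+1 => n /= nt.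
by rewrite ltnS (big_rem n) //= leq_maxl.
Qed.

Lemma height_unbounded (rho : nat -> V) : injective rho ->
    (forall n, Phi (rho n)) -> (forall n, cone Delta (rho n)) ->
  forall M : R, \forall n \near \oo, M < ht (rho n).
Proof.
move=> inj hr cr M.
have fin : finite_set (rho @^-1` [set r | [/\ Phi r, cone Delta r & ht r <= M]]).
  apply: finite_preimage (finite_low_roots hPhi hb M).
  by move=> i j _ _; apply: inj.
have [m hm] := finite_nat_bounded fin.
exists m => // n /= mn; rewrite ltNge; apply/negP => le.
have /hm : (rho @^-1` [set r | [/\ Phi r, cone Delta r & ht r <= M]]) n by [].
by rewrite ltnNge mn.
Qed.

Section LimitPoint.
Variables (x : vtop V) (rho : nat -> V).
Hypothesis rho_inj : injective (normalize Delta \o rho).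
Hypothesis rho_root : forall n, Phi (rho n).
Hypothesis rho_cone : forall n, cone Delta (rho n).
Hypothesis rho_cvg : (fun n => normalize Delta (rho n) : vtop V) @ \oo --> x.
Local Notation u := (fun n => normalize Delta (rho n)).

Lemma rho_height n : 0 < ht (rho n).
Proof. exact: (pos_root_height hPhi hb). Qed.

Lemma limit_height : ht x = 1.
Proof.
have h := cvg_height (Delta := Delta) rho_cvg.
have c : (fun n => ht (u n)) @ \oo --> (1 : R).
  rewrite (_ : (fun n => _) = cst 1); first exact: cvg_cst.
  by apply/funext => n; rewrite normalize_height // gt_eqF // rho_height.
by rewrite -(cvg_lim (@Rhausdorff R) h) (cvg_lim (@Rhausdorff R) c).
Qed.

Lemma limit_coord_ge0 i : 0 <= co i x.
Proof.
have h := vtop_cvg_coord (i := i) rho_cvg.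
rewrite -(cvg_lim _ h) //; apply: limr_ge.
  by apply/cvg_ex; eexists; exact: h.
apply: nearW => n; rewrite coord_is_scale mulr_ge0 ?invr_ge0 //.
  by rewrite ltW // rho_height.
by move/(cone_coordP hb): (rho_cone n).
Qed.

Lemma rho_q n : B (u n) (u n) = (ht (rho n) ^+ 2)^-1.
Proof.
rewrite /normalize formZl formZr (root_unit hPhi (rho_root n)) mulr1.
by rewrite -expr2 exprVn.
Qed.

(** Roots have norm 1 and their heights tend to infinity, so the limit roots are
    isotropic. *)
Lemma cvg_q : (fun n => B (u n) (u n)) @ \oo --> (0 : R).
Proof.
have inj : injective rho by move=> i j ij; apply: rho_inj; rewrite /= ij.
apply/cvgrPdist_le => d d0.
have := height_unbounded inj rho_root rho_cone (1 + d^-1).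
apply: filterS => n hn; rewrite sub0r normrN rho_q normrV ?unitfE; last first.
  by rewrite expf_neq0 // gt_eqF // rho_height.
have d1 : 0 < d^-1 by rewrite invr_gt0.
rewrite ger0_norm ?sqr_ge0 // -[leRHS]invrK.
rewrite lef_pV2 ?posrE // ?exprn_gt0 ?rho_height //.
rewrite expr2; nra.
Qed.

(** When B a x <> 0, the quadric q = 0 crosses the line through x and a
    transversally at x; so the nearby line through a and a normalized root
    meets it near x. *)
Lemma nonradical_limit a : a \in Delta -> B a x != 0 ->
  closure (dihedral_limit_roots B Phi Delta) x.
Proof.
move=> aD b0.
pose be n := B a (u n); pose q n := B (u n) (u n).
have cbe : be @ \oo --> B a x by apply: cvg_form.
have cdisc : (fun n => be n ^+ 2 - q n) @ \oo --> (B a x) ^+ 2.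
  rewrite -[X in _ --> X]subr0; apply: cvgB; last exact: cvg_q.
  by apply: (@cvgM R).
(* The solution near 0 of q n + 2 (be n) t + t^2 = 0, which says that
   u n + t a is isotropic. *)
pose t n := - be n + Num.sg (B a x) * Num.sqrt (be n ^+ 2 - q n).
have ct : t @ \oo --> (0 : R).
  rewrite (_ : 0 = - B a x + Num.sg (B a x) * Num.sqrt (B a x ^+ 2)); last first.
    by rewrite sqrtr_sqr mulr_sg_norm addNr.
  apply: cvgD; first exact: cvgN.
  apply: (@cvgMl_tmp R).
  by apply: (@cvg_comp _ _ _ _ (@Num.sqrt R) _ _ _ cdisc); apply: sqrt_continuous.
have cy : (fun n => normalize Delta (u n + t n *: a) : vtop V) @ \oo --> x.
  have xE : x = normalize Delta ((x : V) + 0 *: a).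
    by rewrite scale0r addr0 /normalize limit_height invr1 scale1r.
  rewrite [X in _ --> X]xE; apply: (@cvg_normalize _ _ _ hb).
    by apply: (@cvg_addZ _ _ _ hb).
  by rewrite scale0r addr0 limit_height oner_neq0.
have ev_disc : \forall n \near \oo, 0 < be n ^+ 2 - q n.
  by apply: (cvgr_gt _ cdisc); rewrite exprn_even_gt0.
have ev_t : \forall n \near \oo, -1 < t n.
  by apply: (cvgr_gt _ ct); rewrite oppr_lt0.
have ev_q : \forall n \near \oo, q n < 1 by apply: (cvgr_lt _ cvg_q).
have ev : \forall n \near \oo,
    dihedral_limit_roots B Phi Delta (normalize Delta (u n + t n *: a)).
  near=> n.
  have disc0 : 0 < be n ^+ 2 - q n by near: n.
  have t0 : -1 < t n by near: n.
  have q1 : q n < 1 by near: n.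
  have h0 := rho_height n; set h := ht (rho n) in h0.
  have a_root : Phi a := simple_root hPhi aD.
  have a_cone : cone Delta a := cone_simple hb aD.
  have a_ht : ht a = 1 by have [i ->] := simple_index aD; apply: height_simple.
  have uE : u n + t n *: a = h^-1 *: (rho n + (h * t n) *: a).
    by rewrite scalerDr scalerA mulrA mulVf ?mul1r // gt_eqF.
  rewrite uE normalizeZ ?invr_eq0 ?gt_eqF //.
  apply: (dihedral_limit hPhi hb) => //.
  - move=> ra; move: q1; rewrite /q /normalize ra a_ht invr1 scale1r.
    by rewrite (root_unit hPhi a_root) ltxx.
  - have hbe : B (rho n) a = h * be n.
      by rewrite /be /normalize formZr formC mulrA mulfV ?mul1r // gt_eqF.
    have hq : 1 = h ^+ 2 * q n.
      by rewrite /q rho_q mulfV // expf_neq0 // gt_eqF.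
    rewrite hbe [X in X + _ + _]hq.
    have -> : h ^+ 2 * q n + 2 * (h * t n) * (h * be n) + (h * t n) ^+ 2 =
        h ^+ 2 * ((t n + be n) ^+ 2 - (be n ^+ 2 - q n)) by ring.
    rewrite /t addrAC addNr add0r exprMn sqr_sqrtr ?(ltW disc0) //.
    by rewrite sqr_sg b0 mul1r subrr mulr0.
  - have : h * ht (u n + t n *: a) != 0.
      apply: mulf_neq0; first by rewrite gt_eqF.
      have rho0 : ht (rho n) != 0 by rewrite gt_eqF // rho_height.
      rewrite heightD normalize_height // heightZ a_ht mulr1 gt_eqF //.
      by rewrite -ltrBlDl sub0r.
    by rewrite uE heightZ mulrA mulfV ?mul1r // gt_eqF.
move=> A nA; have [m _ hm] := filterI ev (cy _ nA).
by have [h1 h2] := hm m (leqnn m); eexists; split; [exact: h1|exact: h2].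
Unshelve. all: by end_near. Qed.
End LimitPoint.
End LimitRoots.

(** * Orthogonal splittings of the simple system *)

Section RadicalLimit.
Variables (R : realType) (V : vectType R) (B : {symmetric V}) (Phi : set V)
  (Delta : seq V).
Hypothesis hPhi : based_root_system B Phi Delta.
Hypothesis hb : basis_of fullv Delta.
Implicit Types (r u v y : V).
Local Notation co := (coord (in_tuple Delta)).
Local Notation ht := (height Delta).
Local Notation s := (reflection B).
Local Notation D i := (nth 0 Delta (@nat_of_ord (size Delta) i)).
Local Notation node := 'I_(size Delta).

Let hD : simple_system B Delta := hPhi.1.

Lemma form_simple_unit (i : node) : B (D i) (D i) = 1.
Proof. by apply: (simple_norm hD); apply: mem_nth. Qed.

Lemma form_offdiag (i j : node) : i != j -> B (D i) (D j) <= 0.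
Proof.
move=> ij.
have ne : D i != D j by rewrite nth_uniq // (simple_uniq hD).
have [h|[k k2 ->]] := simple_form hD (mem_nth 0 (ltn_ord i))
  (mem_nth 0 (ltn_ord j)) ne; first by rewrite (le_trans h) // lerN10.
have k0 : (0 : R) < k%:R by rewrite ltr0n (leq_trans _ k2).
rewrite oppr_le0 cos_ge0_pihalf //.
have p0 := pi_ge0 R.
have h0 : 0 <= pi / k%:R :> R by rewrite divr_ge0 // ltW.
apply/andP; split; first by rewrite (le_trans _ h0) // oppr_le0 divr_ge0.
by rewrite ler_wpM2l // lef_pV2 ?posrE // ler_nat.
Qed.

Definition orthogonal_split (K : pred node) :=
  forall i j : node, K i -> ~~ K j -> B (D i) (D j) = 0.

Definition vanishes_off (K : pred node) v := forall i, ~~ K i -> co i v = 0.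

Lemma orthogonal_splitC K : orthogonal_split K -> orthogonal_split (predC K).
Proof. by move=> h i j /= Ki; rewrite negbK => Kj; rewrite formC h. Qed.

Lemma form_vanishes K v j : orthogonal_split K -> vanishes_off K v -> ~~ K j ->
  B (D j) v = 0.
Proof.
move=> hK hv Kj; rewrite [v](coord_sumE hb) form_sumr big1 // => i _.
rewrite formZr; have [Ki|Ki] := boolP (K i); first by rewrite formC hK // mulr0.
by rewrite hv // mul0r.
Qed.

Lemma reflection_vanishes K v j : orthogonal_split K -> vanishes_off K v ->
  vanishes_off K (s (D j) v).
Proof.
move=> hK hv; have [Kj|Kj] := boolP (K j); last first.
  by rewrite reflection_fix //; apply: form_vanishes Kj.
move=> i Ki; rewrite unit_reflectionE ?form_simple_unit //.
rewrite coord_is_sub coord_is_scale hv // coord_simple //.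
have -> : (i == j) = false by apply: contraNF Ki => /eqP ->.
by rewrite mulr0 subr0.
Qed.

Lemma act_vanishes K v w : orthogonal_split K -> {subset w <= Delta} ->
  vanishes_off K v -> vanishes_off K (act B w v).
Proof.
move=> hK wD hv; elim: w wD => [|a w IH] wD; first by rewrite act_nil.
rewrite act_cons; have [i ->] := simple_index (wD a (mem_head _ _)).
apply: reflection_vanishes => //; apply: IH => b bw.
by apply: wD; rewrite in_cons bw orbT.
Qed.

(** Roots are conjugate to simple roots, and the Weyl group preserves both
    orthogonal summands. *)
Lemma root_split K r : orthogonal_split K -> Phi r ->
  vanishes_off K r \/ vanishes_off (predC K) r.
Proof.
move=> hK /(rootP hPhi)[w [a [wD /simple_index[i ->] ->]]].
have single (K' : pred node) : K' i -> vanishes_off K' (D i).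
  move=> Ki j Kj; rewrite coord_simple //.
  by have -> : (j == i) = false by apply: contraNF Kj => /eqP ->.
have [Ki|Ki] := boolP (K i); [left|right]; apply: act_vanishes => //.
- exact: single.
- exact: orthogonal_splitC.
- exact: single.
Qed.

(** * Limit roots in the radical *)

Variable x : V.
Hypothesis x_ge0 : forall i, 0 <= co i x.
Hypothesis x_height : ht x = 1.
Hypothesis x_rad : forall v, B v x = 0.
Local Notation c i := (co i x).

Definition in_support (i : node) := 0 < c i.
Definition supported v := vanishes_off in_support v.

Lemma support_not i : ~~ in_support i -> c i = 0.
Proof.
by rewrite /in_support -leNgt => h; apply/eqP; rewrite eq_le h x_ge0.
Qed.

Lemma support_nonempty : exists i, in_support i.
Proof.
apply: contrapT => no; have := x_height; rewrite /height big1 => [/eqP|i _].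
  by rewrite eq_sym oner_eq0.
by apply: support_not; apply/negP => h; apply: no; exists i.
Qed.

(** For j off the support, 0 = B (D j) x is a sum of nonpositive terms, which
    therefore all vanish. *)
Lemma support_split : orthogonal_split in_support.
Proof.
move=> i j hi /support_not cj.
have := x_rad (D j); rewrite {1}[x](coord_sumE hb) form_sumr.
have term k : B (D j) (c k *: D k) <= 0.
  rewrite formZr; have [->|kj] := eqVneq k j; first by rewrite cj mul0r.
  by rewrite mulr_ge0_le0 // form_offdiag // eq_sym.
move=> /eqP; rewrite -oppr_eq0 -sumrN psumr_eq0; last first.
  by move=> k _; rewrite oppr_ge0.
move=> /allP/(_ i (mem_index_enum _)); rewrite oppr_eq0 formZr mulf_eq0.
by rewrite gt_eqF //= formC => /eqP.
Qed.

Lemma supportedD u v : supported u -> supported v -> supported (u + v).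
Proof. by move=> hu hv i hi; rewrite coord_is_add hu // hv // addr0. Qed.

Lemma supportedZ a v : supported v -> supported (a *: v).
Proof. by move=> hv i hi; rewrite coord_is_scale hv // mulr0. Qed.

Lemma supported_simple i : in_support i -> supported (D i).
Proof.
move=> hi j hj; rewrite coord_simple //.
by have -> : (j == i) = false by apply: contraNF hj => /eqP ->.
Qed.

Local Notation slope v i := (co i v / c i).

Lemma supported_coord v i : supported v -> co i v = c i * slope v i.
Proof.
move=> hv; have [hi|hi] := boolP (in_support i).
  by rewrite mulrC divfK // gt_eqF.
by rewrite (hv i hi) (support_not hi) mul0r.
Qed.

(** The identity behind the Perron-Frobenius argument: as B kills x, twice the
    form is a sum of squares of differences of slopes, whose weights
    - B (D i) (D j) * c i * c j are nonnegative for i <> j. *)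
Lemma form_sum_squares v : supported v ->
  \sum_i \sum_j B (D i) (D j) * c i * c j * (slope v i - slope v j) ^+ 2 =
  - 2 * B v v.
Proof.
move=> hv.
have row i : \sum_j B (D i) (D j) * c j = 0.
  have := x_rad (D i); rewrite {1}[x](coord_sumE hb) form_sumr => e.
  by apply: etrans e; apply: eq_bigr => j _; rewrite formZr mulrC.
have qE : B v v = \sum_i \sum_j
    B (D i) (D j) * c i * c j * (slope v i * slope v j).
  rewrite {1}[v](coord_sumE hb) form_suml; apply: eq_bigr => i _.
  rewrite formZl {2}[v](coord_sumE hb) form_sumr mulr_sumr.
  apply: eq_bigr => j _; rewrite formZr {1}(supported_coord i hv).
  by rewrite {1}(supported_coord j hv); ring.
have z1 : \sum_i (c i * slope v i ^+ 2) * (\sum_j B (D i) (D j) * c j) = 0.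
  by rewrite big1 // => i _; rewrite row mulr0.
have z2 : \sum_i \sum_j (c j * slope v j ^+ 2) * (B (D j) (D i) * c i) = 0.
  by rewrite exchange_big big1 // => j _; rewrite -mulr_sumr row mulr0.
rewrite mulNr -[RHS]add0r -[X in X - _]addr0.
rewrite -[X in X + 0 - _]z1 -[X in _ + X - _]z2.
rewrite qE mulr_sumr -sumrN -!big_split; apply: eq_bigr => i _ /=.
rewrite !mulr_sumr -sumrN -!big_split; apply: eq_bigr => j _ /=.
by rewrite (formC _ (D j) (D i)); ring.
Qed.

Lemma form_square_le0 v i j :
  B (D i) (D j) * c i * c j * (slope v i - slope v j) ^+ 2 <= 0.
Proof.
have [->|ij] := eqVneq i j; first by rewrite subrr expr0n mulr0.
by rewrite !mulr_le0_ge0 ?sqr_ge0 // form_offdiag.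
Qed.

Lemma form_psd v : supported v -> 0 <= B v v.
Proof.
move=> /form_sum_squares h.
have : - 2 * B v v <= 0.
  rewrite -h -oppr_ge0 -sumrN; apply: sumr_ge0 => i _.
  by rewrite -sumrN; apply: sumr_ge0 => j _; rewrite oppr_ge0 form_square_le0.
lra.
Qed.

Lemma form_isotropic_slopes v i j : supported v -> B v v = 0 ->
  B (D i) (D j) * c i * c j * (slope v i - slope v j) ^+ 2 = 0.
Proof.
move=> /form_sum_squares h v0; move: h; rewrite v0 mulr0 => /eqP.
rewrite -oppr_eq0 -sumrN psumr_eq0; last first.
  move=> k _; rewrite -sumrN; apply: sumr_ge0 => l _.
  by rewrite oppr_ge0 form_square_le0.
move=> /allP/(_ i (mem_index_enum _)); rewrite -sumrN psumr_eq0; last first.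
  by move=> l _; rewrite oppr_ge0 form_square_le0.
by move=> /allP/(_ j (mem_index_enum _)); rewrite oppr_eq0 => /eqP.
Qed.

Lemma form_cauchy_schwarz u v : supported u -> supported v -> B v v = 1 ->
  B u v ^+ 2 <= B u u.
Proof.
move=> hu hv v1; have := form_psd (supportedD hu (supportedZ (- B u v) hv)).
by rewrite !formE v1 (formC B v u); lra.
Qed.

(** The roots near x in direction are full; a single one of them shows that the
    support of x is connected in the Coxeter graph. *)
Definition full_root r := Phi r /\ forall i, in_support i -> 0 < co i r.

Lemma full_supported r : full_root r -> supported r.
Proof.
move=> [hr fr]; have [//|h] := root_split support_split hr.
have [i hi] := support_nonempty.
have := h i; rewrite /= negbK => /(_ hi) e.
by have := fr i hi; rewrite e ltxx.
Qed.

Variable full : V.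
Hypothesis full_rootP : full_root full.

(** The slopes of an isotropic vector are constant along the edges of the
    Coxeter graph, so their level sets split the support orthogonally; a full
    root rules out a proper splitting. *)
Lemma isotropic_radical v : supported v -> B v v = 0 -> v = ht v *: x.
Proof.
move=> hv v0; have [i0 hi0] := support_nonempty.
pose K : pred node := [pred i | in_support i && (slope v i == slope v i0)].
have hK : orthogonal_split K.
  move=> i j /= /andP[hi /eqP wi] /nandP[hj|wj]; first exact: support_split.
  have [hj|hj] := boolP (in_support j); last exact: support_split.
  have /eqP := form_isotropic_slopes i j hv v0.
  rewrite mulf_eq0 sqrf_eq0 wi subr_eq0 [slope v i0 == _]eq_sym (negbTE wj) orbF.
  by rewrite !mulf_eq0 (gt_eqF hi) (gt_eqF hj) !orbF => /eqP.
have vE : v = slope v i0 *: x.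
  have [h|h] := root_split hK full_rootP.1; last first.
    have e : co i0 full = 0 by apply: h; apply/negPn/andP.
    by have := full_rootP.2 _ hi0; rewrite e ltxx.
  apply: (coord_inj hb) => i; rewrite coord_is_scale.
  have [hi|hi] := boolP (in_support i); last first.
    by rewrite (hv _ hi) (support_not hi) mulr0.
  have [/andP[_ /eqP <-]|Ki] := boolP (K i); first by rewrite divfK // gt_eqF.
  by have := full_rootP.2 _ hi; rewrite h // ltxx.
by rewrite {1}vE; congr (_ *: _); rewrite [in RHS]vE heightZ x_height mulr1.
Qed.

(** * Finiteness in the affine component *)

(** By Cauchy-Schwarz, B u r is bounded over the roots r. *)
Lemma low_roots_finite u : supported u ->
  finite_set [set r | [/\ Phi r, cone Delta r, supported r & ht r <= B u r]].
Proof.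
move=> hu; apply: sub_finite_set (finite_low_roots hPhi hb (1 + B u u)).
move=> r /= [hr cr sr pr]; split=> //.
have := form_cauchy_schwarz hu sr (root_unit hPhi hr).
have := sqr_ge0 (B u r - 1); rewrite !expr2; nra.
Qed.

(** Away from the node b the form is nondegenerate, so some u has B u = ht on the
    other nodes of the support; then ht r = B u r is bounded by Cauchy-Schwarz. *)
Lemma corank_one_finite (b : node) : in_support b ->
  finite_set [set r | [/\ Phi r, cone Delta r, supported r & co b r = 0]].
Proof.
move=> hb0.
pose J : pred node := [pred i | in_support i && (i != b)].
(* The Gram matrix of the nodes in J, extended by the identity. *)
pose Gm : 'M[R]_(size Delta) := \matrix_(i, j)
  if J i && J j then B (D i) (D j) else (i == j)%:R.
have GmJ (k : 'rV[R]_(size Delta)) (j : node) : J j ->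
    (k *m Gm) 0 j = B (\sum_(i | J i) k 0 i *: D i) (D j).
  move=> Jj; rewrite mxE form_suml [LHS](bigID J) /= [X in _ + X]big1 ?addr0.
    by apply: eq_bigr => i Ji; rewrite formZl mxE Ji Jj.
  move=> i Ji; rewrite mxE (negbTE Ji) /=.
  have -> : (i == j) = false by apply: contraNF Ji => /eqP ->.
  by rewrite mulr0.
have Gm_nJ (k : 'rV[R]_(size Delta)) (j : node) : ~~ J j ->
    (k *m Gm) 0 j = k 0 j.
  move=> Jj; rewrite mxE (bigD1 j) //= mxE (negbTE Jj) andbF eqxx mulr1.
  rewrite big1 ?addr0 // => i ij.
  by rewrite mxE (negbTE Jj) andbF (negbTE ij) mulr0.
have suppJ (k : 'rV[R]_(size Delta)) : supported (\sum_(i | J i) k 0 i *: D i).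
  apply: (big_ind supported) => [i _|y z|i Ji].
  - by rewrite linear0.
  - exact: supportedD.
  - by apply/supportedZ/supported_simple; case/andP: Ji.
have coJ (k : 'rV[R]_(size Delta)) j :
    co j (\sum_(i | J i) k 0 i *: D i) = if J j then k 0 j else 0.
  rewrite big_mkcond (eq_bigr (fun i => (if J i then k 0 i else 0) *: D i)).
    by rewrite coord_lincomb.
  by move=> i _; case: (J i); rewrite ?scale0r.
have free : row_free Gm.
  apply: inj_row_free => k k0.
  pose v := \sum_(i | J i) k 0 i *: D i.
  have cov j : co j v = if J j then k 0 j else 0 by apply: coJ.
  have Bv j : J j -> B v (D j) = 0 by move=> Jj; rewrite -GmJ // k0 mxE.
  have vv : B v v = 0.
    by rewrite {2}/v form_sumr big1 // => i Ji; rewrite formZr Bv // mulr0.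
  have vx := isotropic_radical (suppJ k : supported v) vv.
  clearbody v; have htv : ht v = 0.
    have : co b v = 0 by rewrite cov ifN // negb_and negbK eqxx orbT.
    rewrite {1}vx coord_is_scale => /eqP.
    by rewrite mulf_eq0 (gt_eqF hb0) orbF => /eqP.
  rewrite htv scale0r in vx.
  apply/rowP => j; rewrite mxE.
  have [Jj|Jj] := boolP (J j); last by rewrite -(Gm_nJ k j Jj) k0 mxE.
  by have := cov j; rewrite Jj vx linear0.
have /row_fullP[N NG] : row_full Gm := free.
pose k : 'rV[R]_(size Delta) := const_mx 1 *m N.
pose u := \sum_(i | J i) k 0 i *: D i.
have uJ j : J j -> B u (D j) = 1.
  by move=> Jj; rewrite -GmJ // -mulmxA NG mulmx1 mxE.
apply: sub_finite_set (finite_low_roots hPhi hb (1 + B u u)).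
move=> r /= [hr cr sr rb]; split=> //.
have htE : ht r = B u r.
  rewrite {2}[r](coord_sumE hb) form_sumr; apply: eq_bigr => i _.
  rewrite formZr; have [Ji|] := boolP (J i); first by rewrite uJ // mulr1.
  move=> /nandP[/sr ->|/negPn/eqP ->]; first by rewrite mul0r.
  by rewrite rb mul0r.
have := form_cauchy_schwarz (suppJ k) sr (root_unit hPhi hr).
rewrite -/u -htE; have := sqr_ge0 (ht r - 1); rewrite !expr2; nra.
Qed.

Lemma act_supported w v : {subset w <= Delta} -> supported v ->
  supported (act B w v).
Proof. by move=> wD; apply: act_vanishes => //; apply: support_split. Qed.

(** Each simple reflection in a node where p is negative removes one positive
    root from the finite set where p is negative. *)
Lemma chamber_descent (L : seq V) (p : V -> R) :
    (forall u v, p (u + v) = p u + p v) -> (forall a v, p (a *: v) = a * p v) ->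
    (forall r, Phi r -> cone Delta r -> supported r -> p r < 0 -> r \in L) ->
  exists2 w, {subset w <= Delta} &
    forall i, in_support i -> 0 <= p (act B w (D i)).
Proof.
have [n] := ubnP (size L); elim: n L p => // n IH L p sL pD pZ pL.
have [[i [hi pi0]]|no] := pselect (exists i, in_support i /\ p (D i) < 0);
    last first.
  exists [::] => // i hi; rewrite act_nil leNgt; apply/negP => lt.
  by apply: no; exists i.
have iD : D i \in Delta by apply: mem_nth.
have i1 : B (D i) (D i) = 1 by apply: form_simple_unit.
have iroot : Phi (D i) by apply: (simple_root hPhi).
have icone : cone Delta (D i) by apply: (cone_simple hb).
have isup : supported (D i) by apply: supported_simple.
have pN v : p (- v) = - p v by rewrite -scaleN1r pZ mulN1r.
pose L' := [seq s (D i) r | r <- L & r != D i].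
have sL' : (size L' < n)%N.
  have iL : D i \in L by apply: pL.
  rewrite size_map size_filter -ltnS (leq_trans _ sL) // ltnS.
  rewrite -(count_predC [pred r | r != D i] L) -[ltnLHS]addn0 ltn_add2l.
  by rewrite -has_count; apply/hasP; exists (D i); rewrite //= eqxx.
have [||r hr cr sr pr|w wD hw] := IH L' (p \o s (D i)) sL'.
- by move=> u v; rewrite /= linearD pD.
- by move=> a v; rewrite /= linearZ pZ.
- have ri : r <> D i.
    by move=> E; move: pr; rewrite E /= reflection_root // pN; lra.
  rewrite -(reflection_invol r i1); apply: map_f; rewrite mem_filter.
  apply/andP; split.
    apply/eqP => E; have := reflection_invol r i1; rewrite E reflection_root //.
    move=> rE; have := cone_antisym hb icone; rewrite rE => /(_ cr) /eqP.
    by rewrite (negbTE (root_neq0 hPhi iroot)).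
  apply: pL => //.
  - exact: (reflection_closed hPhi).
  - exact: (simple_reflection_pos hPhi hb).
  - by apply: reflection_vanishes => //; apply: support_split.
exists (D i :: w); first by move=> y; rewrite in_cons => /orP[/eqP ->|/wD].
by move=> j hj; rewrite act_cons; apply: hw.
Qed.

Lemma act_radical w : act B w x = x.
Proof. by apply: act_fix => a _. Qed.

(** If |B r a| < 1 then some linear form p = ht - B u vanishes at r and a and
    is 1 at x. Moving p into the fundamental chamber by the Weyl group
    moves r and a to roots that miss a node where p is positive; those are
    finitely many. *)
Lemma finite_form_values : exists L : seq R, forall r a,
  Phi r -> supported r -> Phi a -> supported a -> `|B r a| < 1 -> B r a \in L.
Proof.
have F (b : node) : exists S : seq V, in_support b ->
    forall r, Phi r -> supported r -> co b r = 0 -> r \in S.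
  have [hb0|nb] := boolP (in_support b); last by exists [::].
  have /finite_seqP[S SE] := corank_one_finite hb0.
  exists (S ++ [seq - r | r <- S]) => _ r hr sr br; rewrite mem_cat.
  have [cr|cr] := root_sign hPhi hb hr.
    have : [set` S] r by rewrite -SE.
    by rewrite /= => ->.
  have : [set` S] (- r).
    rewrite -SE; split=> //; first exact: (rootN hPhi).
      by rewrite -scaleN1r; apply: supportedZ.
    by rewrite coord_is_opp br oppr0.
  by move=> /= rS; rewrite -[r in X in _ || X]opprK map_f ?orbT.
have [S hS] := choice F.
pose T := flatten [seq S b | b <- enum 'I_(size Delta)].
have hT b r : in_support b -> Phi r -> supported r -> co b r = 0 -> r \in T.
  move=> h1 h2 h3 h4; apply/flattenP; exists (S b); last exact: hS.
  by apply: map_f; rewrite mem_enum.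
exists [seq B r a | r <- T, a <- T] => r a hr sr ha sa rab.
have [r1 a1] := (root_unit hPhi hr, root_unit hPhi ha).
set k := B r a in rab *.
have d0 : 1 - k ^+ 2 != 0.
  rewrite subr_eq0 eq_sym -(expr1n _ 2) eqf_sqr; apply/norP; split.
    by apply: contraTneq rab => ->; rewrite normr1 ltxx.
  by apply: contraTneq rab => ->; rewrite normrN normr1 ltxx.
(* The solution u in the plane of r and a of B u r = ht r and B u a = ht a. *)
pose al := (ht r - k * ht a) / (1 - k ^+ 2).
pose be := (ht a - k * ht r) / (1 - k ^+ 2).
pose u := al *: r + be *: a.
have su : supported u by apply: supportedD; apply: supportedZ.
pose p v := ht v - B u v.
have pr : p r = 0.
  by rewrite /p /u !formE r1 (formC B a r) -/k /al /be; field.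
have pa : p a = 0.
  by rewrite /p /u !formE a1 -/k /al /be; field.
have pD v y : p (v + y) = p v + p y by rewrite /p heightD formDr; lra.
have pZ e v : p (e *: v) = e * p v by rewrite /p heightZ formZr; ring.
have px : p x = 1 by rewrite /p x_rad subr0.
have /finite_seqP[L LE] := low_roots_finite su.
have [|w wD hw] := chamber_descent (L := L) pD pZ.
  move=> y hy cy sy py.
  have : [set` L] y by rewrite -LE; split=> //; rewrite -subr_le0 ltW.
  by [].
have wu := simple_word_unit hD wD.
pose pw v := p (act B w v).
have pwE v : pw v = \sum_i co i v * pw (D i).
  rewrite {1}[v](coord_sumE hb) /pw linear_sum.
  rewrite (big_morph p pD (_ : p 0 = 0)).
    by apply: eq_bigr => i _; rewrite linearZ pZ.
  by rewrite -(scale0r (0 : V)) pZ mul0r.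
have [b hb0 pb] : exists2 b, in_support b & 0 < pw (D b).
  apply: contrapT => no.
  have : pw x <= 0.
    rewrite pwE -oppr_ge0 -sumrN; apply: sumr_ge0 => i _.
    rewrite oppr_ge0; have [hi|hi] := boolP (in_support i).
      rewrite mulr_ge0_le0 // leNgt; apply/negP => h; apply: no.
      by exists i.
    by rewrite support_not // mul0r.
  by rewrite /pw act_radical px ler10.
have vanish y : Phi y -> supported y -> pw y = 0 -> co b y = 0.
  wlog cy : y / cone Delta y.
    move=> hwlog hy sy py; have [cy|cy] := root_sign hPhi hb hy.
      exact: hwlog.
    apply/eqP; rewrite -oppr_eq0 -coord_is_opp; apply/eqP.
    apply: hwlog => //; first exact: (rootN hPhi).
      by rewrite -scaleN1r; apply: supportedZ.
    by rewrite -scaleN1r /pw linearZ pZ -/(pw y) py mulr0.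
  move=> hy sy /eqP; rewrite pwE psumr_eq0; last first.
    move=> i _; have [hi|hi] := boolP (in_support i).
      rewrite mulr_ge0 //; last exact: hw.
      by move/(cone_coordP hb): cy.
    by rewrite (sy i hi) mul0r.
  move=> /allP/(_ b (mem_index_enum _)); rewrite mulf_eq0 (gt_eqF pb) orbF.
  by move/eqP.
have back y : Phi y -> supported y -> p y = 0 -> act B (rev w) y \in T.
  have rwD : {subset rev w <= Delta} by move=> z; rewrite mem_rev; apply: wD.
  move=> hy sy py; have h1 := act_root hPhi rwD hy.
  have h2 := act_supported rwD sy.
  apply: (hT b) => //; apply: vanish => //.
  by rewrite /pw act_Krev.
rewrite /k -(act_isometry r a (unit_word_rev wu)).
by apply: allpairs_f; apply: back.
Qed.

(** The values B r (D i), finitely many by the previous lemma, determine r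
    modulo the radical; so two of infinitely many roots differ by a multiple of
    x, which lies on the line through them. *)
Lemma radical_limit :
  infinite_set [set r | [/\ Phi r, cone Delta r & supported r]] ->
  dihedral_limit_roots B Phi Delta (x : vtop V).
Proof.
move=> inf; have [L hL] := finite_form_values.
(* 0 off the support, 1 and -1 by Cauchy-Schwarz. *)
pose L' := [:: 0, 1, -1 & L].
have hL' r i : Phi r -> supported r -> B r (D i) \in L'.
  move=> hr sr; rewrite !inE.
  have [hi|hi] := boolP (in_support i); last first.
    by rewrite formC (form_vanishes support_split sr hi) eqxx.
  have si := supported_simple hi.
  have : `|B r (D i)| <= 1.
    rewrite -ler_sqr ?nnegrE // real_normK ?num_real // expr1n.
    apply: le_trans (form_cauchy_schwarz sr si (form_simple_unit i)) _.
    by rewrite (root_unit hPhi hr).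
  rewrite le_eqVlt => /orP[|lt].
    by rewrite eqr_norml ler01 andbT => /orP[->|->]; rewrite ?orbT.
  apply/or4P; apply: Or44; apply: hL => //.
  exact: (simple_root hPhi (mem_nth 0 (ltn_ord i))).
pose f r := [ffun i : node => inord (index (B r (D i)) L') : 'I_(size L').+1].
have [r [r' [[hr cr sr] [hr' cr' sr'] rr' frr']]] := pigeonhole f inf.
have eqB i : B r (D i) = B r' (D i).
  have /ffunP/(_ i) := frr'; rewrite !ffunE => /(congr1 (@nat_of_ord _)).
  rewrite !inordK ?ltnS ?index_size // => e.
  by rewrite -(nth_index 0 (hL' r i hr sr)) e nth_index // hL'.
pose y := r - r'.
have By v : B y v = 0.
  rewrite /y formBl [v](coord_sumE hb) !form_sumr -sumrB big1 // => i _.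
  by rewrite !formZr eqB subrr.
have sy : supported y.
  by apply: supportedD => //; rewrite -scaleN1r; apply: supportedZ.
have yx := isotropic_radical sy (By y).
have hty : ht y != 0.
  apply: contra_notN rr' => /eqP e; apply/eqP.
  by rewrite -subr_eq0 -/y yx e scale0r.
have yE : r + (-1) *: r' = y by rewrite scaleN1r.
have -> : x = normalize Delta (r + (-1) *: r').
  by rewrite yE yx normalizeZ // /normalize x_height invr1 scale1r.
apply: (dihedral_limit hPhi hb) => //; last by rewrite yE.
have : B r r' = 1.
  rewrite -(root_unit hPhi hr'); apply/eqP; rewrite -subr_eq0 -formBl.
  by rewrite By.
by move=> ->; rewrite sqrrN expr1n; lra.
Qed.
End RadicalLimit.

(** * Density *)

Theorem theorem4p2 (R : realType) (V : vectType R) (B : {symmetric V}%R)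
    (Phi : set V) (Delta : seq V)
    (hPhi : based_root_system B Phi Delta)
    (hbasis : basis_of fullv Delta)
    (hinf : infinite_set Phi) :
  dense_in (dihedral_limit_roots B Phi Delta) (limit_roots Delta Phi).
Proof.
split=> [x [r1 [r2 [_ _ _ [u [uinj uroot ux]]]]]|x [u [uinj uroot ux]]].
  by exists u; split=> // n; have [r [hr _] rE] := uroot n; exists r.
have rep n : exists r, [/\ Phi r, cone Delta r & u n = normalize Delta r].
  have [r hr <-] := uroot n.
  exact: (positive_representative hPhi hbasis).
have [rho rhoP] := choice rep.
have rho_root n : Phi (rho n) by case: (rhoP n).
have rho_cone n : cone Delta (rho n) by case: (rhoP n).
have uE : u = (fun n => normalize Delta (rho n)).
  by apply/funext => n; case: (rhoP n).
rewrite uE in uinj ux.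
have [[a [aD ax]]|no] := pselect (exists a, a \in Delta /\ B a (x : V) != 0).
  exact: (nonradical_limit hPhi hbasis uinj rho_root rho_cone ux aD ax).
apply: subset_closure.
have x_rad (v : V) : B v (x : V) = 0.
  rewrite [v](coord_sumE hbasis) form_suml big1 // => i _; rewrite formZl.
  apply/eqP; rewrite mulf_eq0; apply/orP; right; apply: contra_notT no => h.
  by eexists; split; [exact: (mem_nth 0 (ltn_ord i))|].
have x_ht := limit_height hPhi hbasis rho_root rho_cone ux.
have x_ge0 := limit_coord_ge0 hPhi hbasis rho_root rho_cone ux.
have [m _ hm] : \forall n \near \oo, forall i : 'I_(size Delta),
    in_support x i -> 0 < coord (in_tuple Delta) i (normalize Delta (rho n)).
  apply: filter_forall => i; have [hi|hi] := boolP (in_support x i); last first.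
    by apply: nearW.
  have [k _ hk] := cvgr_gt _ (vtop_cvg_coord (i := i) ux) _ hi.
  by exists k => // n kn _; apply: hk.
have full n : (m <= n)%N -> full_root Phi Delta x (rho n).
  move=> mn; split=> // i hi; have := hm n mn i hi.
  rewrite coord_is_scale pmulr_rgt0 // invr_gt0.
  exact: (pos_root_height hPhi hbasis).
apply: (radical_limit hPhi hbasis x_ge0 x_ht x_rad (full m (leqnn m))).
move=> fin.
have rho_inj : injective rho by move=> i j ij; apply: uinj; rewrite ij.
have := finite_preimage (fun i j _ _ => @rho_inj i j) fin.
move=> /finite_nat_bounded[k /(_ (m + k)%N)]; rewrite ltnNge leq_addl => h.
suff: ~~ true by []; apply: h; split=> //.
by apply: (full_supported hPhi hbasis x_ge0 x_ht x_rad); apply/full/leq_addr.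
Qed.
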